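(* Let $X,Y$ be Polish spaces and $A,B$ disjoint analytic subsets of $X\times Y$. Then exactly one of the following holds: (a) there is a potentially closed set $D\subseteq X\times Y$ with $A\subseteq D$ and $D\cap B=\emptyset$; (b) there are continuous maps $u:2^\omega\to X$ and $v:2^\omega\to Y$ such that $A_1\subseteq (u\times v)^{-1}(A)$ and $\overline{A_1}\setminus A_1\subseteq (u\times v)^{-1}(B)$. Moreover, this dichotomy becomes false if in (b) the set $\overline{A_1}\setminus A_1$ is replaced by $(2^\omega\times 2^\omega)\setminus A_1$, and it also becomes false if in (b) one additionally requires $u$ and $v$ to be one-to-one.
   Context: Let $\psi:\omega\to 2^{<\omega}$ be the bijection enumerating finite binary sequences by increasing length and, within each length, lexicographically ($\psi(0)=\emptyset,\psi(1)=0,\psi(2)=1,\psi(3)=00,\psi(4)=01,\dots$), so $|\psi(n)|\le n$; put $s_n:=\psi(n)0^{n-|\psi(n)|}$ (so $|s_n|=n$). Define $A_1:=\{(s_n0\gamma,s_n1\gamma): n\in\omega,\ \gamma\in 2^\omega\}\subseteq 2^\omega\times 2^\omega$, and $\overline{A_1}$ its closure. A set $D\subseteq X\times Y$ is potentially closed if there are Polish topologies on $X$ and on $Y$ finer than the original ones making $D$ closed in the product (in particular $D$ is Borel). *)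

(* Defs.v *)
From mathcomp Require Import all_boot all_order all_algebra.
From mathcomp Require Import all_classical all_reals all_analysis.

Set Implicit Arguments.
Unset Strict Implicit.
Unset Printing Implicit Defensive.

Local Open Scope classical_set_scope.

(* [Metric R T] is the type of metric structures carried by [T]. Completeness is
   not expressed with [completeType], whose instances are pointed: a Polish
   space may be empty. *)
Definition polish (R : realType) (T : topologicalType) : Prop :=
  exists M : Metric R T, let TM : metricType R := Metric.Pack M in
  [/\ forall U : set T, open (U : set TM) <-> open U,
      forall F : set_system TM, ProperFilter F -> cauchy F ->
        exists x : TM, F --> x
    & exists2 S : set T, countable S & dense S].

Definition analytic (R : realType) (T : topologicalType) (A : set T) : Prop :=
  exists P : topologicalType, polish R P /\
  exists f : P -> T, continuous f /\ range f = A.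

(* [Topological T] is the type of topologies on the carrier [T]. *)
Definition finer (T : topologicalType) (t : Topological T) : Prop :=
  forall U : set T, open U -> open (U : set (Topological.Pack t)).

Definition potentially_closed (R : realType) (X Y : topologicalType)
    (D : set (X * Y)) : Prop :=
  exists (tX : Topological X) (tY : Topological Y),
  let X' : topologicalType := Topological.Pack tX in
  let Y' : topologicalType := Topological.Pack tY in
  [/\ polish R X' /\ finer tX, polish R Y' /\ finer tY
    & closed (D : set (X' * Y'))].

(* The binary words of length [k], in lexicographic order (false = 0 < 1 = true). *)
Fixpoint words (k : nat) : seq bitseq :=
  if k is k'.+1 then
    [seq false :: w | w <- words k'] ++ [seq true :: w | w <- words k']
  else [:: [::]].

Definition words_below (n : nat) : seq bitseq :=
  flatten [seq words k | k <- iota 0 n].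

(* There are [2 ^ n.+1 - 1 > n] words of length at most [n], so that the
   default value of [nth] is never used. *)
Definition psi (n : nat) : bitseq := nth [::] (words_below n.+1) n.

Definition sword (n : nat) : bitseq := psi n ++ nseq (n - size (psi n)) false.

Definition prepend (w : bitseq) (g : cantor_space) : cantor_space :=
  fun k => if (k < size w)%N then nth false w k else g (k - size w)%N.

Definition A1 : set (cantor_space * cantor_space) :=
  [set p | exists (n : nat) (g : cantor_space),
     p = (prepend (rcons (sword n) false) g, prepend (rcons (sword n) true) g)].

Section psi_facts.

Lemma size_words k : size (words k) = (2 ^ k)%N.
Proof.
by elim: k => //= k IH; rewrite size_cat !size_map IH addnn -mul2n expnS.
Qed.

Lemma mem_words k w : (w \in words k) = (size w == k).
Proof.
elim: k w => [|k IH] [|b w] //=; rewrite mem_cat.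
  by apply/negbTE/negP => /orP[] /mapP[].
rewrite eqSS -IH; apply/orP/idP => [[] /mapP[v vk [_ ->]] //|wk].
by case: b; [right|left]; apply/mapP; exists w.
Qed.

Lemma uniq_words k : uniq (words k).
Proof.
elim: k => //= k IH; rewrite cat_uniq !map_inj_uniq ?IH; try by move=> ? ? [].
by rewrite andbT; apply/hasPn => _ /mapP[w _ ->]; apply/negP => /mapP[].
Qed.

Lemma words_belowS n : words_below n.+1 = words_below n ++ words n.
Proof. by rewrite /words_below -addn1 iotaD map_cat flatten_cat /= cats0. Qed.

Lemma mem_words_below n w : (w \in words_below n) = (size w < n)%N.
Proof.
by elim: n => // n IH; rewrite words_belowS mem_cat IH mem_words ltnS orbC -leq_eqVlt.
Qed.

Lemma uniq_words_below n : uniq (words_below n).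
Proof.
elim: n => // n IH; rewrite words_belowS cat_uniq IH uniq_words andbT.
apply/hasPn => w; rewrite mem_words => /eqP wn.
by rewrite mem_words_below wn ltnn.
Qed.

Lemma size_words_below n : (n <= size (words_below n))%N.
Proof.
elim: n => // n IH; rewrite words_belowS size_cat size_words -addn1.
by rewrite leq_add // expn_gt0.
Qed.

Lemma nth_words_below n m i : (i < size (words_below n))%N -> (n <= m)%N ->
  nth [::] (words_below m) i = nth [::] (words_below n) i.
Proof.
move=> lin; elim: m => [|m IH]; first by rewrite leqn0 => /eqP ->.
rewrite leq_eqVlt => /predU1P[-> //|]; rewrite ltnS => nm.
rewrite words_belowS nth_cat (IH nm) ifT //; apply: leq_trans lin _.
rewrite uniq_leq_size ?uniq_words_below // => w.
by rewrite !mem_words_below => /leq_trans; apply.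
Qed.

Lemma size_psi n : (size (psi n) <= n)%N.
Proof. by rewrite -ltnS -mem_words_below mem_nth // size_words_below. Qed.

Lemma size_sword n : size (sword n) = n.
Proof. by rewrite size_cat size_nseq subnKC // size_psi. Qed.

Lemma psi_inj : injective psi.
Proof.
move=> m n; pose k := (maxn m n).+1.
have E i : (i < k)%N -> psi i = nth [::] (words_below k) i.
  by move=> ik; rewrite (@nth_words_below i.+1) ?size_words_below.
have lt i : (i < k)%N -> (i < size (words_below k))%N.
  by move=> ik; rewrite (leq_trans ik) ?size_words_below.
have mk : (m < k)%N by rewrite ltnS leq_maxl.
have nk : (n < k)%N by rewrite ltnS leq_maxr.
rewrite !E // => /eqP; rewrite nth_uniq ?lt ?uniq_words_below //.
by move/eqP.
Qed.

Lemma psi_surj w : exists n, psi n = w.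
Proof.
have wi : w \in words_below (size w).+1 by rewrite mem_words_below.
exists (index w (words_below (size w).+1)).
rewrite -[RHS](nth_index [::] wi) /psi.
set i := index _ _; set a := (size w).+1.
have ia : (i < size (words_below a))%N by rewrite index_mem.
case: (leqP a i.+1) => [|/ltnW] h; first exact: nth_words_below ia h.
by apply/esym/nth_words_below => //; exact: size_words_below.
Qed.

End psi_facts.

Definition reducible (E0 E1 : set (cantor_space * cantor_space))
    (X Y : topologicalType) (A B : set (X * Y)) : Prop :=
  exists (u : cantor_space -> X) (v : cantor_space -> Y),
  let uv := fun p : cantor_space * cantor_space => (u p.1, v p.2) in
  [/\ continuous u, continuous v, E0 `<=` uv @^-1` A & E1 `<=` uv @^-1` B].

Definition inj_reducible (E0 E1 : set (cantor_space * cantor_space))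
    (X Y : topologicalType) (A B : set (X * Y)) : Prop :=
  exists (u : cantor_space -> X) (v : cantor_space -> Y),
  let uv := fun p : cantor_space * cantor_space => (u p.1, v p.2) in
  [/\ continuous u /\ injective u, continuous v /\ injective v,
      E0 `<=` uv @^-1` A & E1 `<=` uv @^-1` B].

Definition pot_closed_separable (R : realType) (X Y : topologicalType)
    (A B : set (X * Y)) : Prop :=
  exists D : set (X * Y),
    [/\ potentially_closed R D, A `<=` D & D `&` B = set0].

Definition exactly_one (P Q : Prop) : Prop := (P \/ Q) /\ ~ (P /\ Q).

Definition dichotomy (R : realType)
    (alt : forall X Y : topologicalType, set (X * Y) -> set (X * Y) -> Prop)
    : Prop :=
  forall X Y : topologicalType, polish R X -> polish R Y ->
  forall A B : set (X * Y), analytic R A -> analytic R B -> A `&` B = set0 ->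
  exactly_one (pot_closed_separable R A B) (alt X Y A B).

(* Main.v *)
(* The words [sword n] being dense, [closure A1 `\` A1] is the diagonal, so (b) asks for
   a continuous map [a |-> (u a, v a)] from the Cantor space to [B] which is a
   homomorphism from the digraph [A1] to the digraph relating [p] to [q] when
   [(p.1, q.2)] is in [A], while (a) says that [B] is covered by countably many Borel
   rectangles disjoint from [A]. The dichotomy is thus an instance of the G_0-dichotomy
   of Kechris, Solecki and Todorcevic, proved here in the style of B. Miller: finite
   approximations of a homomorphism that cannot be extended yield rectangles disjoint
   from [A], made Borel by Lusin separation; once countably many of them are removed
   from [B], either nothing remains or approximations extend for ever and converge.
   That (a) and (b) exclude each other is a Baire category argument.

   The pair formed by [A1] and the diagonal refutes the first strengthening of (b). For
   the second, the images of [A1] and of the diagonal under [(a, b) |-> (a, collapse b)]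
   are used, where [collapse] is continuous, separates the ends of each pair of [A1],
   and identifies suitable points in every copy of [A1]. *)
Require Import Defs.
From HB Require Import structures.
From mathcomp Require Import all_boot all_order all_algebra.
From mathcomp Require Import all_classical all_reals all_analysis.
From mathcomp Require Import zify lra.

Set Implicit Arguments.
Unset Strict Implicit.
Unset Printing Implicit Defensive.

Import Order.TTheory GRing.Theory Num.Theory.
Import numFieldNormedType.Exports.

Local Open Scope classical_set_scope.
Local Open Scope ring_scope.

(** * Metrics and Polish spaces *)

(** Alternative (a) lets the topologies change. Countably many Borel rectangles become open in
    suitable finer Polish topologies, obtained by transporting to [T] the metric of the graph of a
    sequence of real functions that is closed in [T * R^nat]; this opens all the required sets at
    once, without a transfinite construction. Conversely, an open set of a finer Polish topology is
    Borel for the original one, by Suslin's theorem.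

    The construction of (b) needs countably many approximations, and limits that respect [A] and [B]
    although neither is closed. Both come from parametrising [A] and [B] by the Baire space: an
    approximation fixes finitely many digits of finitely many codes, whereas a configuration is a
    choice of complete codes satisfying the edge relations exactly. Successive configurations share
    only the digits already fixed, so the codes converge digit by digit, and continuity of the
    parametrisations carries the edge relations to the limit. *)

Section MetricAxioms.
Variables (R : realType) (T : Type).

Record metric_axioms (d : T -> T -> R) : Prop := MetricAxioms {
  dist_xx : forall x, d x x = 0;
  dist_eq0 : forall x y, d x y = 0 -> x = y;
  dist_sym : forall x y, d x y = d y x;
  dist_triangle : forall y x z, d x z <= d x y + d y z }.

Definition dist_cvg (d : T -> T -> R) (u : nat -> T) (l : T) : Prop :=
  forall e : R, 0 < e -> exists N, forall n, (N <= n)%N -> d (u n) l < e.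

Definition dist_cauchy (d : T -> T -> R) (u : nat -> T) : Prop :=
  forall e : R, 0 < e -> exists N, forall m n, (N <= m)%N -> (N <= n)%N ->
    d (u m) (u n) < e.

Lemma dist_ge0 (d : T -> T -> R) x y : metric_axioms d -> 0 <= d x y.
Proof.
by move=> ax; have := dist_triangle ax y x x; rewrite dist_xx // (dist_sym ax y); lra.
Qed.

End MetricAxioms.

(** [polish] unpacked into a bare distance function, with completeness tested on sequences: in this
    form other distances can be built by hand on the same carrier. *)
Record complete_metric (R : realType) (T : topologicalType) (d : T -> T -> R) :
    Prop := CompleteMetric {
  cm_axioms : metric_axioms d;
  cm_open : forall U : set T, open U <->
    forall x, U x -> exists2 e : R, 0 < e & forall y, d x y < e -> U y;
  cm_complete : forall u, dist_cauchy d u -> exists l, dist_cvg d u l }.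

Definition dist_dense (R : realType) (T : Type) (d : T -> T -> R) (S : set T) :=
  forall x (e : R), 0 < e -> exists2 y, S y & d x y < e.

(** A fresh name for [T], indexed by the axioms, so that the structure built from [d] does not
    compete with a topology that [T] already has. *)
Definition metric_alias (R : realType) (T : choiceType) (d : T -> T -> R)
  (ax : metric_axioms d) : Type := T.

Section MetricAlias.
Variables (R : realType) (T : choiceType) (d : T -> T -> R).
Variable ax : metric_axioms d.

HB.instance Definition _ := Choice.on (metric_alias ax).
HB.instance Definition _ := isMetric.Build R (metric_alias ax)
  (dist_xx ax) (dist_eq0 ax) (dist_sym ax) (dist_triangle ax).

Lemma alias_open (U : set (metric_alias ax)) : open U <->
  forall x, U x -> exists2 e : R, 0 < e & forall y, d x y < e -> U y.
Proof.
rewrite openE; split=> [oU x /oU|oU x /oU [e e0 exU]].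
  by rewrite /interior -nbhs_ballE => -[e /= e0 exU]; exists e.
by rewrite /interior -nbhs_ballE; exists e => // y /exU.
Qed.

End MetricAlias.

Definition metric_topology (R : realType) (T : choiceType) (d : T -> T -> R)
  (ax : metric_axioms d) : Topological T := Topological.on (metric_alias ax).

Lemma metric_topologyP (R : realType) (T : choiceType) (d : T -> T -> R)
    (ax : metric_axioms d) (U : set T) :
  open (U : set (Topological.Pack (metric_topology ax))) <->
  forall x, U x -> exists2 e : R, 0 < e & forall y, d x y < e -> U y.
Proof. exact: alias_open. Qed.

Section PolishMetric.
Variable R : realType.

Definition eps (n : nat) : R := n.+1%:R^-1.

Lemma eps_gt0 n : 0 < eps n. Proof. by rewrite invr_gt0 ltr0n. Qed.

Lemma eps_lt (e : R) : 0 < e -> exists n, eps n < e.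
Proof.
move=> e0; exists (Num.truncn e^-1); rewrite /eps invf_plt ?posrE ?ltr0n //.
exact: truncnS_gt.
Qed.

Lemma eps_le m n : (m <= n)%N -> eps n <= eps m.
Proof. by move=> mn; rewrite /eps lef_pV2 ?posrE ?ltr0n // ler_nat. Qed.

Lemma polish_metric (T : topologicalType) : polish R T ->
  exists d : T -> T -> R, complete_metric d /\
    exists2 S, countable S & dist_dense d S.
Proof.
case=> M /= [oM cM [S cS dS]].
pose TM : metricType R := Metric.Pack M.
exists (@mdist R TM); split; last first.
  exists S => // x e e0.
  have oB : open (ball (x : TM) e : set TM).
    rewrite openE => y; rewrite ballEmdist /= => xy.
    rewrite /interior -nbhs_ballE; exists (e - mdist (x : TM) y).
      by rewrite /= subr_gt0.
    move=> z; rewrite !ballEmdist /= => yz.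
    have := metric_triangle (x : TM) y z; lra.
  have /dS : (ball (x : TM) e : set T) !=set0.
    by exists x; exact: ballxx.
  by move=> /(_ ((oM _).1 oB)) [y [By Sy]]; exists y => //; rewrite ballEmdist in By.
split.
- split; [exact: (@mdistxx R TM)|exact: (@mdist_positivity R TM)|exact: (@metric_sym R TM)|].
  by move=> y x z; exact: (@metric_triangle R TM).
- move=> U; rewrite -oM openE; split=> [oU x /oU|oU x /oU [e e0 exU]].
    rewrite /interior -nbhs_ballE => -[e /= e0 exU]; exists e => // y.
    by move: (exU y); rewrite ballEmdist.
  by rewrite /interior -nbhs_ballE; exists e => // y; rewrite ballEmdist => /exU.
- move=> u cu; pose F := (fmap (u : nat -> TM) \oo : set_system TM).
  have [|x Fx] := cM F _.
    apply/cauchy_ballP => e e0; have [N Nu] := cu e e0.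
    exists ([set u n | n in [set n | (N <= n)%N]], [set u n | n in [set n | (N <= n)%N]]).
      by split; exists N => // n Nn; exists n.
    by move=> [_ _] [[m /= Nm <-] [n /= Nn <-]] /=; rewrite ballEmdist; exact: Nu.
  exists x => e e0; have := Fx _ (nbhsx_ballx (x : TM) e e0).
  move=> [N _ NB]; exists N => n /NB /=.
  by rewrite metric_sym ballEmdist.
Qed.

Lemma metric_polish (T : topologicalType) (d : T -> T -> R) (S : set T) :
  complete_metric d -> countable S -> dist_dense d S -> polish R T.
Proof.
move=> [ax oT cT] cS dS.
pose TM : metricType R := metric_alias ax.
exists (Metric.on TM) => /=.
have oE (U : set T) : open (U : set TM) <-> open U.
  by rewrite oT; exact: alias_open.
split => //.
- move=> F PF cF.
  have /choice[x xF] n : exists x : T, F (ball (x : TM) (eps n)).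
    by have /cauchyP/(_ _ (eps_gt0 n)) := cF.
  have xB (n : nat) (y : T) : ball (x n : TM) (eps n) y = (d (x n) y < eps n) by [].
  have [e e0|l xl] := cT x.
    have [N Ne] : exists N, eps N < e / 2 by apply: eps_lt; lra.
    exists N => m n Nm Nn.
    have [y [my ny]] := filter_ex (filterI (xF m) (xF n)).
    rewrite !xB in my ny.
    have := dist_triangle ax y (x m) (x n); rewrite (dist_sym ax y).
    have := lt_le_trans my (eps_le Nm); have := lt_le_trans ny (eps_le Nn). lra.
  exists l => U /(@nbhs_ballP R TM)[e /= e0 lU].
  have [N xN] := xl _ (@divr_gt0 _ e 2 e0 ltac:(lra)).
  have [M Me] : exists N, eps N < e / 2 by apply: eps_lt; lra.
  apply: filterS (xF (maxn M N)) => y; rewrite xB => xy.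
  apply: lU; rewrite /ball/=.
  have := dist_triangle ax (x (maxn M N)) l y; rewrite (dist_sym ax l (x _)).
  have := xN _ (leq_maxr M N); have := lt_le_trans xy (eps_le (leq_maxl M N)); lra.
- exists S => // U [x Ux] oU.
  have [e e0 exU] := (oT U).1 oU x Ux.
  by have [y Sy xy] := dS x e e0; exists y; split => //; exact: exU.
Qed.

End PolishMetric.

(** * Sequence spaces *)

Definition agree (K : Type) (n : nat) (a b : nat -> K) : Prop :=
  forall i, (i < n)%N -> b i = a i.

Lemma agree_trans (K : Type) n (b a c : nat -> K) : agree n a b -> agree n b c -> agree n a c.
Proof. by move=> ab bc i ni; rewrite bc // ab. Qed.

Lemma agree_le (K : Type) m n (a b : nat -> K) : (m <= n)%N -> agree n a b -> agree m a b.
Proof. by move=> mn ab i im; rewrite ab // (leq_trans im). Qed.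

Section SequenceSpace.
Variable K : discreteTopologicalType.
Local Notation S := (prod_topology (fun _ : nat => K)).

Lemma nbhs_seqP (a : S) (U : set S) :
  nbhs a U <-> exists n, forall b, agree n a b -> U b.
Proof.
split=> [aU|[n nU]].
  apply: contrapT => /forallNP H.
  have /choice[b bP] n : exists b : S, agree n a b /\ ~ U b.
    by have /existsNP[b /not_implyP[ab Ub]] := H n; exists b.
  have bcvg : b @ \oo --> a.
    apply/cvg_sup => i V [W [[W' oW' <-] W'a] WV].
    apply: (filterS WV); rewrite nbhs_simpl; exists i.+1 => // n /= ni.
    by rewrite /preimage/= (bP n).1.
  have /bcvg [N _ /(_ N (leqnn N))] := aU.
  by case: (bP N).
apply: (@filterS _ _ (nbhs_filter a) [set b | agree n a b]) => //.
elim: n {nU} => [|n IH]; first by apply: (@filterS _ _ (nbhs_filter _) _ _ _ filterT) => b _ i.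
have an : nbhs a [set b : S | b n = a n].
  apply: (@proj_continuous _ (fun _ => K) n a [set a n]).
  by rewrite nbhs_principalE; apply/principal_filterP.
apply: filterS (filterI IH an) => b [ab bn] i.
by rewrite ltnS leq_eqVlt => /predU1P[->//|]; exact: ab.
Qed.

Lemma open_seqP (U : set S) :
  open U <-> forall a, U a -> exists n, forall b, agree n a b -> U b.
Proof. by rewrite openE; split=> H a /H /nbhs_seqP. Qed.

Lemma continuous_seqP (T : topologicalType) (f : S -> T) :
  continuous f <-> forall a U, open U -> U (f a) ->
    exists n, forall b, agree n a b -> U (f b).
Proof.
split=> [cf a U oU Ufa|H a U].
  by apply/nbhs_seqP; apply: cf; apply: open_nbhs_nbhs.
rewrite nbhsE => -[V [oV Va] VU]; apply/nbhs_seqP.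
by have [n nV] := H a V oV Va; exists n => b /nV /VU.
Qed.

Lemma continuous_to_seqP (T : topologicalType) (f : T -> S) :
  continuous f <-> forall i, continuous (fun x => f x i).
Proof.
split=> [cf i x|H x U].
  apply: (@continuous_comp _ _ _ f (fun a : S => a i)); first exact: cf.
  exact: (@proj_continuous _ (fun _ => K)).
move/nbhs_seqP=> [n nU]; rewrite nbhs_simpl /=.
apply: (@filterS _ _ (nbhs_filter x) [set y | agree n (f x) (f y)]) => [y /nU //|].
elim: n {nU} => [|n IH]; first by apply: (@filterS _ _ (nbhs_filter _) _ _ _ filterT) => b _ i.
have xn : nbhs x [set y | f y n = f x n].
  apply: (H n x [set f x n]).
  by rewrite nbhs_principalE; apply/principal_filterP.
apply: filterS (filterI IH xn) => b [ab bn] i.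
by rewrite ltnS leq_eqVlt => /predU1P[->//|]; exact: ab.
Qed.

End SequenceSpace.

Definition baire_space : Type := prod_topology (fun _ : nat => nat).

HB.instance Definition _ := Pointed.on baire_space.
HB.instance Definition _ := Nbhs.on baire_space.
HB.instance Definition _ := Topological.on baire_space.

Section SeqDist.
Variables (R : realType) (K : eqType).
Implicit Types a b c : nat -> K.

Definition seq_dist a b : R :=
  if pselect (exists n, a n != b n) is left ex then eps R (ex_minn ex) else 0.

Lemma seq_dist_ge a b n : a n != b n -> eps R n <= seq_dist a b.
Proof.
rewrite /seq_dist => abn; case: pselect => [ex|[]]; last by exists n.
by case: ex_minnP => m _ /(_ n abn) mn; exact: eps_le.
Qed.

Lemma seq_dist_agree a b n : agree n a b -> seq_dist a b <= eps R n.
Proof.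
rewrite /seq_dist => ab; case: pselect => [ex|_]; last exact/ltW/eps_gt0.
case: ex_minnP => m abm _; apply: eps_le; rewrite leqNgt.
by apply: contra abm => /ab ->.
Qed.

Lemma agree_seq_dist a b n : seq_dist a b < eps R n -> agree n.+1 a b.
Proof.
move=> abn i; rewrite ltnS => lein; apply/eqP; rewrite eq_sym; apply: contraTT abn.
by move=> /seq_dist_ge abi; rewrite -leNgt (le_trans _ abi) // eps_le.
Qed.

Lemma seq_dist_ge0 a b : 0 <= seq_dist a b.
Proof. by rewrite /seq_dist; case: pselect => // ?; exact/ltW/eps_gt0. Qed.

Lemma seq_dist_axioms : metric_axioms seq_dist.
Proof.
split.
- by move=> a; rewrite /seq_dist; case: pselect => // ex; have [n /eqP] := ex.
- move=> a b d0; apply/funext => n; apply/eqP; apply/negPn/negP => /seq_dist_ge.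
  by rewrite d0 leNgt eps_gt0.
- move=> a b; apply/eqP; rewrite eq_le; apply/andP.
  suff H c e : seq_dist c e <= seq_dist e c by [].
  rewrite {1}/seq_dist; case: pselect => [ex|_]; last exact: seq_dist_ge0.
  by case: ex_minnP => m + _; rewrite eq_sym => /seq_dist_ge.
- move=> b a c; rewrite {1}/seq_dist; case: pselect => [ex|_]; last first.
    by rewrite addr_ge0 // seq_dist_ge0.
  case: ex_minnP => m acm _; have [abm|abm] := eqVneq (a m) (b m).
    by rewrite ler_wpDl ?seq_dist_ge0 // seq_dist_ge // -abm.
  by rewrite ler_wpDr ?seq_dist_ge0 // seq_dist_ge.
Qed.

Lemma seq_dist_complete u : dist_cauchy seq_dist u -> exists l, dist_cvg seq_dist u l.
Proof.
move=> cu.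
have /choice[N NP] n : exists N, forall m, (N <= m)%N -> agree n.+1 (u N) (u m).
  have [N Nu] := cu _ (eps_gt0 R n); exists N => m Nm.
  exact/agree_seq_dist/Nu.
exists (fun n => u (N n) n) => e /eps_lt[n ne].
exists (\max_(i < n.+1) N i) => m Nm.
apply: le_lt_trans ne; apply: seq_dist_agree => i lein /=.
rewrite -(NP i m) //; apply: leq_trans Nm.
exact: (leq_bigmax (Ordinal (ltnW lein : (i < n.+1)%N))).
Qed.

End SeqDist.

Section Separability.
Variable R : realType.

(** One representative is chosen for each attained value of each [code n]. No dense points have to
    be exhibited, only countable data that determine a point up to a given precision. *)
Lemma dense_of_codes (T : choiceType) (C : countType) (d : T -> T -> R)
    (code : nat -> T -> C) :
  (forall e : R, 0 < e -> exists n, forall x y, code n x = code n y -> d x y < e) ->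
  exists2 S, countable S & dist_dense d S.
Proof.
move=> H; have [[x0 _]|noT] := pselect (exists x : T, True); last first.
  by exists set0 => // x; case: noT; exists x.
pose g (nc : nat * C) := xget x0 [set x | code nc.1 x = nc.2].
exists (range g).
  exact: sub_countable (card_image_le _ _) (countableP _).
move=> x e /H[n nP]; exists (g (n, code n x)); first by exists (n, code n x).
apply/nP/esym; rewrite /g; case: xgetP => //= nx; exfalso; exact: (nx x).
Qed.

Lemma dense_sequence (T : topologicalType) (x0 : T) : polish R T ->
  exists d : T -> T -> R, complete_metric d /\
    exists x : nat -> T, forall y (e : R), 0 < e -> exists n, d y (x n) < e.
Proof.
case/polish_metric=> d [cm [S /countable_injP[f fI] dS]]; exists d; split=> //.
pose x n := xget x0 [set y | S y /\ f y = n].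
exists x => y e /(dS y)[z Sz yz]; exists (f z).
suff -> : x (f z) = z by [].
rewrite /x; case: xgetP => [w _ [Sw fw]|/(_ z)[]//].
by apply: fI => //; rewrite inE.
Qed.

Lemma polish_seq (T : topologicalType) (K : countType) (to : T -> nat -> K)
    (of_ : (nat -> K) -> T) :
  cancel to of_ -> cancel of_ to ->
  (forall U : set T, open U <->
    forall a, U a -> exists n, forall b, agree n (to a) (to b) -> U b) ->
  polish R T.
Proof.
move=> toK ofK oT; pose d (x y : T) := seq_dist R (to x) (to y).
have [//|S cS dS] := @dense_of_codes T (seq K) d (fun n x => mkseq (to x) n).
  move=> e /eps_lt[n ne]; exists n => x y xy.
  apply: le_lt_trans ne; apply: seq_dist_agree => i lein.
  by rewrite -(nth_mkseq (to x 0) (to y) lein) -xy nth_mkseq.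
apply: (metric_polish _ cS dS); split.
- have [d1 d2 d3 d4] := seq_dist_axioms R K; split=> *; rewrite /d //.
  by apply: (can_inj toK); exact: d2.
- move=> U; rewrite oT; split=> H x Ux; have := H x Ux.
    move=> [n nU]; exists (eps R n); first exact: eps_gt0.
    by move=> y /agree_seq_dist xy; apply: nU; exact: agree_le (leqnSn n) xy.
  move=> [e /eps_lt[n ne] eU]; exists n => y /(seq_dist_agree R) xy.
  exact/eU/(le_lt_trans xy).
- move=> u /seq_dist_complete[l ul]; exists (of_ l) => e e0.
  have [N NP] := ul e e0; exists N => n /NP.
  by rewrite /d ofK.
Qed.

Lemma polish_baire : polish R baire_space.
Proof.
apply: (@polish_seq baire_space nat id id) => // U.
exact: (@open_seqP nat).
Qed.

Lemma polish_cantor : polish R cantor_space.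
Proof.
apply: (@polish_seq cantor_space bool id id) => // U.
exact: (@open_seqP bool).
Qed.

Lemma polish_hausdorff (T : topologicalType) : polish R T -> hausdorff_space T.
Proof.
case/polish_metric=> d [[ax oT _] _] x y xy; apply: contrapT => /eqP nxy.
have dxy : 0 < d x y.
  rewrite lt_neqAle dist_ge0 // andbT eq_sym; apply: contraNN nxy => /eqP.
  by move/(dist_eq0 ax) ->.
have B z : nbhs z [set w | d z w < d x y / 2].
  apply: open_nbhs_nbhs; split; last by rewrite /= dist_xx //; lra.
  apply/oT => w /= zw; exists (d x y / 2 - d z w); first lra.
  by move=> v wv; have := dist_triangle ax w z v; lra.
have [z [/= xz yz]] := xy _ _ (B x) (B y).
by have := dist_triangle ax z x y; rewrite (dist_sym ax z); lra.
Qed.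

End Separability.

(** * Continuous surjections from the Baire space onto nonempty Polish spaces *)

Section BaireImage.
Variables (R : realType) (T : topologicalType) (d : T -> T -> R) (x : nat -> T).
Hypothesis cm : complete_metric d.
Hypothesis dx : forall y (e : R), 0 < e -> exists n, d y (x n) < e.

Local Notation half n := (2^-1 ^+ n : R).

(* Jumping to the next prescribed point only when it is close makes every [a] give a
   Cauchy sequence, while the points close to a given limit remain admissible. *)
Fixpoint walk (a : nat -> nat) (n : nat) : T :=
  if n is m.+1 then
    if d (walk a m) (x (a m.+1)) < half m then x (a m.+1) else walk a m
  else x (a 0%N).

Let ax := cm_axioms cm.

Lemma walk_step a n : d (walk a n) (walk a n.+1) <= half n.
Proof.
rewrite /=; case: ifP => [/ltW//|_].
by rewrite dist_xx // exprn_ge0 // invr_ge0.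
Qed.

(** The geometric sum of the step bounds, kept as a difference because this form closes the
    induction on [k]. *)
Lemma walk_dist a n k : d (walk a n) (walk a (n + k)) <= 2 * half n - 2 * half (n + k).
Proof.
elim: k => [|k IH]; first by rewrite addn0 dist_xx // subrr.
rewrite addnS; have := walk_step a (n + k).
have := dist_triangle ax (walk a (n + k)) (walk a n) (walk a (n + k).+1).
by rewrite exprS; lra.
Qed.

Lemma half_lt (e : R) : 0 < e -> exists n, 2 * half n < e.
Proof.
move=> e0; have [n ne] : exists n, half n < e / 2.
  have : (half n @[n --> \oo] --> (0 : R)).
    by apply: cvg_expr; rewrite ger0_norm ?invr_ge0 // invf_lt1 // ltr1n.
  move/cvgrPdist_lt/(_ (e / 2)); case; first lra.
  move=> n _ /(_ n (leqnn n)); rewrite sub0r normrN ger0_norm ?exprn_ge0 ?invr_ge0 //.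
  by exists n.
by exists n; lra.
Qed.

Lemma half_ge0 n : 0 <= half n. Proof. by rewrite exprn_ge0 // invr_ge0. Qed.

Lemma walk_near a n m : (n <= m)%N -> d (walk a n) (walk a m) <= 2 * half n.
Proof.
by move=> /subnKC <-; have := walk_dist a n (m - n); have := half_ge0 (n + (m - n)); lra.
Qed.

Lemma walk_cauchy a : dist_cauchy d (walk a).
Proof.
move=> e e0; have [N Ne] := @half_lt (e / 2) ltac:(lra).
exists N => m n /(walk_near a) Nm /(walk_near a) Nn.
by have := dist_triangle ax (walk a N) (walk a m) (walk a n); rewrite (dist_sym ax _ (walk a N)); lra.
Qed.

Definition walk_lim a : T := sval (cid (cm_complete cm (walk_cauchy a))).

Lemma walk_lim_near a n : d (walk a n) (walk_lim a) <= 2 * half n.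
Proof.
have /= cv := svalP (cid (cm_complete cm (walk_cauchy a))).
apply/ler_addgt0Pl => e e0; have [N NP] := cv e e0.
have := NP _ (leq_maxl N n); rewrite -/(walk_lim a) => ae.
have := walk_near a (leq_maxr N n).
have := dist_triangle ax (walk a (maxn N n)) (walk a n) (walk_lim a); lra.
Qed.

Lemma walk_agree a b n : agree n.+1 a b -> walk b n = walk a n.
Proof.
elim: n => [|n IH] ab /=; first by rewrite ab.
by rewrite IH ?ab //; exact: agree_le ab.
Qed.

Lemma walk_lim_continuous : continuous (walk_lim : baire_space -> T).
Proof.
apply/(@continuous_seqP nat) => a U /(cm_open cm) oU /oU[e e0 eU].
have [n ne] := @half_lt (e / 2) ltac:(lra).
exists n.+1 => b /walk_agree ab; apply: eU.
have := walk_lim_near a n; have := walk_lim_near b n; rewrite ab.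
have := dist_triangle ax (walk a n) (walk_lim a) (walk_lim b).
rewrite (dist_sym ax _ (walk a n)); lra.
Qed.

Lemma walk_lim_surj y : exists a, walk_lim a = y.
Proof.
(* With points chosen within [half n / 4] of [y], consecutive ones are less than [half n] apart, so
   every jump is admissible and [walk a] visits exactly the chosen points. *)
have h0 n : 0 < half n / 4 by rewrite divr_gt0 // exprn_gt0 // invr_gt0.
have /choice[a aP] n := dx y (h0 n).
exists a; have H n : walk a n = x (a n).
  elim: n => [//|n IH] /=; rewrite IH ifT //.
  have := dist_triangle ax y (x (a n)) (x (a n.+1)).
  rewrite (dist_sym ax _ y); have := aP n; have := aP n.+1; rewrite exprS.
  have := h0 n; lra.
apply/(dist_eq0 ax)/eqP; rewrite eq_le dist_ge0 // andbT.
apply/ler_addgt0Pl => e e0; have [n ne] := @half_lt (e / 2) ltac:(lra).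
rewrite addr0.
have := walk_lim_near a n; have := aP n; rewrite -H.
have := dist_triangle ax (walk a n) (walk_lim a) y.
rewrite (dist_sym ax (walk_lim a) (walk a n)) (dist_sym ax y).
have := h0 n; lra.
Qed.

End BaireImage.

(** * Suslin and Borel sets *)

Lemma polish_baire_image (R : realType) (T : topologicalType) (x0 : T) :
  polish R T ->
  exists f : baire_space -> T, continuous f /\ forall y, exists a, f a = y.
Proof.
move=> /(dense_sequence x0)[d [cm [x dx]]].
by exists (walk_lim x cm); split; [exact: walk_lim_continuous|exact: walk_lim_surj].
Qed.

(* Projections of closed subsets of [baire_space * T]; for Polish [T] these are
   the analytic sets, but no case distinction is needed for empty [T]. *)
Definition suslin (T : topologicalType) (S : set T) : Prop :=
  exists F : set (baire_space * T),
    closed F /\ forall x, S x <-> exists a, F (a, x).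

Section BaireCoding.
Variable I : countType.

(** A point of the Baire space stores a family indexed by [I], one member per strand, so that a
    single existential witness can serve countably many closed conditions. *)
Definition strand (i : I) (a : baire_space) : baire_space :=
  fun j => a (pickle (i, j)).

Definition braid (f : I -> baire_space) : baire_space :=
  fun k => if unpickle k is Some (i, j) then f i j else 0%N.

Lemma strand_braid f i : strand i (braid f) = f i.
Proof. by apply/funext => j; rewrite /strand /braid pickleK. Qed.

Lemma strand_continuous i : continuous (strand i).
Proof.
apply/(@continuous_to_seqP nat) => j.
exact: (@proj_continuous _ (fun _ => nat)).
Qed.

End BaireCoding.

Lemma continuous_pair (T U V : topologicalType) (f : T -> U) (g : T -> V) :
  continuous f -> continuous g -> continuous (fun x => (f x, g x)).
Proof. by move=> cf cg x; apply: cvg_pair; [exact: cf|exact: cg]. Qed.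

Lemma closed_continuous_preimage (T U : topologicalType) (f : T -> U) (F : set U) :
  continuous f -> closed F -> closed (f @^-1` F).
Proof. by move=> cf cF; apply: preimage_closed => // x _; exact: cf. Qed.

Lemma continuous_fst (T U : topologicalType) : continuous (@fst T U).
Proof. by move=> x; exact: cvg_fst. Qed.

Lemma continuous_snd (T U : topologicalType) : continuous (@snd T U).
Proof. by move=> x; exact: cvg_snd. Qed.

Lemma continuous_compose (T U V : topologicalType) (f : T -> U) (g : U -> V) :
  continuous f -> continuous g -> continuous (g \o f).
Proof. by move=> cf cg x; apply: continuous_comp; [exact: cf|exact: cg]. Qed.

Lemma closed_equalizer (T U : topologicalType) (f g : T -> U) : hausdorff_space U ->
  continuous f -> continuous g -> closed [set x | f x = g x].
Proof.
move=> hU cf cg x clx; apply: hU => A B fA gB.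
have xAB : nbhs x (f @^-1` A `&` g @^-1` B).
  by apply: filterI; [exact: cf|exact: cg].
have [y [/= e [Ay By]]] := clx _ xAB.
by exists (f y); split => //; rewrite e.
Qed.

Section SuslinTheory.
Implicit Types T U : topologicalType.

Lemma suslin_closed T (S : set T) : closed S -> suslin S.
Proof.
move=> cS; exists (snd @^-1` S); split.
  by apply: closed_continuous_preimage => //; exact: continuous_snd.
by move=> x; split=> [Sx|[]//]; exists (point : baire_space).
Qed.

Lemma suslin_preimage T U (f : T -> U) (S : set U) :
  continuous f -> suslin S -> suslin (f @^-1` S).
Proof.
move=> cf [F [cF SF]]; exists ((fun p => (p.1, f p.2)) @^-1` F); split.
  apply: closed_continuous_preimage => //; apply: continuous_pair; first exact: continuous_fst.
  exact: continuous_compose (@continuous_snd _ _) cf.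
by move=> x; rewrite /= SF.
Qed.

Lemma suslin_forall T (I : countType) (S : I -> set T) :
  (forall i, suslin (S i)) -> suslin [set x | forall i, S i x].
Proof.
move=> /choice[F FP].
exists (\bigcap_i ((fun p => (strand i p.1, p.2)) @^-1` (F i))); split.
  apply: closed_bigI => i _; apply: closed_continuous_preimage; last exact: (FP i).1.
  apply: continuous_pair; last exact: continuous_snd.
  exact: continuous_compose (@continuous_fst _ _) (@strand_continuous _ i).
move=> x; split=> [Sx|[a aF] i]; last first.
  by apply/(FP i).2; exists (strand i a); exact: aF.
have /choice[a aP] i : exists a, F i (a, x) by apply/(FP i).2/Sx.
by exists (braid a) => i _ /=; rewrite strand_braid.
Qed.

Lemma suslin_exists T (I : countType) (S : I -> set T) :
  (forall i, suslin (S i)) -> suslin [set x | exists i, S i x].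
Proof.
move=> /choice[F FP].
(* A union is turned into an intersection of closed sets: the first entry of strand 0 names the
   chosen index, and [G k] is vacuous unless that entry is [k]. An entry that names no index is
   rejected by [set0]. *)
pose G (k : nat) : set (baire_space * T) := [set p | strand 0%N p.1 0%N <> k] `|`
  (if unpickle k is Some i then (fun p => (strand 1%N p.1, p.2)) @^-1` (F i) else set0).
have cr i : continuous (fun p : baire_space * T => strand (i : nat) p.1).
  exact: continuous_compose (@continuous_fst _ _) (@strand_continuous _ i).
exists (\bigcap_k G k); split.
  apply: closed_bigI => k _; apply: closedU.
    apply: (@closed_continuous_preimage _ _ (fun p : baire_space * T => strand 0%N p.1 0%N) [set~ k]).
      apply: (continuous_compose (g := fun a : baire_space => a 0%N) (cr 0%N)).
      exact: (@proj_continuous _ (fun _ => nat)).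
    exact: discrete_closed.
  case: (unpickle k) => [i|]; last exact: closed0.
  apply: closed_continuous_preimage; last exact: (FP i).1.
  by apply: continuous_pair; [exact: cr|exact: continuous_snd].
move=> x; split=> [[i Six]|[a aG]].
  have [a aF] := ((FP i).2 x).1 Six.
  exists (braid (fun j : nat => if j is 0%N then (fun=> pickle i) : baire_space else a)).
  move=> k _; have [<-|ki] := pselect (pickle i = k).
    by right; rewrite pickleK /= strand_braid.
  by left; rewrite /= strand_braid.
have := aG (strand 0%N a 0%N) Logic.I; case=> [//|].
by case: unpickle => //= i aF; exists i; apply/(FP i).2; exists (strand 1%N a).
Qed.

Lemma suslinT T : suslin (@setT T).
Proof. exact/suslin_closed/closedT. Qed.

Lemma suslin0 T : suslin (@set0 T).
Proof. exact/suslin_closed/closed0. Qed.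

Lemma suslinI T (S S' : set T) : suslin S -> suslin S' -> suslin (S `&` S').
Proof.
move=> sS sS'; rewrite (_ : _ `&` _ = [set x | forall b : bool, (if b then S else S') x]).
  by apply: suslin_forall; case.
by apply/seteqP; split=> x /= => [[Sx S'x] []//|H]; split; [exact: H true|exact: H false].
Qed.

Lemma suslinU T (S S' : set T) : suslin S -> suslin S' -> suslin (S `|` S').
Proof.
move=> sS sS'; rewrite (_ : _ `|` _ = [set x | exists b : bool, (if b then S else S') x]).
  by apply: suslin_exists; case.
apply/seteqP; split=> x /= => [[Sx|S'x]|[[] H]]; [|by exists false|by left|by right].
by exists true.
Qed.

Lemma suslin_baire_proj T (S : set (baire_space * T)) :
  suslin S -> suslin [set x | exists a, S (a, x)].
Proof.
move=> [F [cF SF]].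
exists ((fun p => (strand true p.1, (strand false p.1, p.2))) @^-1` F); split.
  apply: closed_continuous_preimage => //; apply: continuous_pair.
    exact: continuous_compose (@continuous_fst _ _) (@strand_continuous _ _).
  apply: continuous_pair; last exact: continuous_snd.
  exact: continuous_compose (@continuous_fst _ _) (@strand_continuous _ _).
move=> x; split=> [[a /SF[b Fb]]|[c Fc]].
  by exists (braid (fun i => if i then b else a)); rewrite /= !strand_braid.
by exists (strand false c); apply/SF; exists (strand true c).
Qed.

Lemma suslin_polish_proj (R : realType) T U (S : set (U * T)) : polish R U ->
  suslin S -> suslin [set x | exists y, S (y, x)].
Proof.
move=> pU sS; have [[y0 _]|noU] := pselect (exists y : U, True); last first.
  rewrite (_ : mkset _ = set0); first exact: suslin0.
  by rewrite -subset0 => x [y _]; apply: noU; exists y.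
have [f [cf fU]] := polish_baire_image y0 pU.
rewrite (_ : mkset _ = [set x | exists a, ((fun p => (f p.1, p.2)) @^-1` S) (a, x)]).
  apply: suslin_baire_proj; apply: suslin_preimage sS.
  apply: continuous_pair; last exact: continuous_snd.
  exact: continuous_compose (@continuous_fst _ _) cf.
apply/seteqP; split=> x /= [y]; last by exists (f y).
by have [a <-] := fU y; exists a.
Qed.

Lemma suslin_image (R : realType) T U (f : U -> T) (S : set U) :
  polish R U -> hausdorff_space T -> continuous f -> suslin S -> suslin (f @` S).
Proof.
move=> pU hT cf sS.
rewrite (_ : f @` S = [set x | exists y, (fst @^-1` S `&` [set p | f p.1 = p.2]) (y, x)]).
  apply: (suslin_polish_proj pU); apply: suslinI.
    by apply: suslin_preimage sS; exact: continuous_fst.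
  apply: suslin_closed; apply: closed_equalizer => //; last exact: continuous_snd.
  exact: continuous_compose (@continuous_fst _ _) cf.
by apply/seteqP; split=> x /= => [[y Sy <-]|[y [Sy <-]]]; exists y.
Qed.

End SuslinTheory.

(** * Borel sets and Lusin separation *)

Section Borel.
Variable T : topologicalType.

Inductive borel : set T -> Prop :=
| borel_open U : open U -> borel U
| borel_compl E : borel E -> borel (~` E)
| borel_bigcup (E : nat -> set T) : (forall n, borel (E n)) -> borel (\bigcup_n E n).

Lemma borel_bigcap (E : nat -> set T) :
  (forall n, borel (E n)) -> borel (\bigcap_n E n).
Proof.
move=> bE; rewrite -[X in borel X]setCK setC_bigcap.
by apply/borel_compl/borel_bigcup => n; exact: borel_compl.
Qed.

Lemma borel0 : borel set0. Proof. exact/borel_open/open0. Qed.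

Lemma borelI E E' : borel E -> borel E' -> borel (E `&` E').
Proof.
move=> bE bE'; rewrite (_ : _ `&` _ = \bigcap_n (if n is 0%N then E else E')).
  by apply: borel_bigcap; case.
apply/seteqP; split=> x => [[Ex E'x] [|n] _ //|H].
by split; [exact: H 0%N I|exact: H 1%N I].
Qed.

Definition borel_separated (A B : set T) :=
  exists E, [/\ borel E, A `<=` E & E `&` B = set0].

Lemma borel_separated_bigcup (A B : nat -> set T) :
  (forall i j, borel_separated (A i) (B j)) ->
  borel_separated (\bigcup_i A i) (\bigcup_j B j).
Proof.
move=> H; have /choice[E EP] (ij : nat * nat) : exists E,
    [/\ borel E, A ij.1 `<=` E & E `&` B ij.2 = set0] by exact: H.
exists (\bigcup_i \bigcap_j E (i, j)); split.
- by apply: borel_bigcup => i; apply: borel_bigcap => j; case: (EP (i, j)).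
- move=> x [i _ Aix]; exists i => // j _.
  by case: (EP (i, j)) => _ /(_ _ Aix).
- rewrite -subset0 => x [[i _ Eix] [j _ Bjx]].
  by case: (EP (i, j)) => _ _ <- /=; split => //; exact: Eix.
Qed.

End Borel.

Lemma borel_preimage (T U : topologicalType) (f : T -> U) (E : set U) :
  continuous f -> borel E -> borel (f @^-1` E).
Proof.
move=> cf; elim=> [V oV|F _ bF|F _ bF].
- by apply: borel_open; apply: open_comp => // x _; exact: cf.
- exact: borel_compl.
- by rewrite preimage_bigcup; exact: borel_bigcup.
Qed.

Section LusinSeparation.
Variables (T : topologicalType) (h : baire_space -> T) (C D : set baire_space).
Hypotheses (hT : hausdorff_space T) (ch : continuous h).
Hypotheses (cC : closed C) (cD : closed D) (CD0 : h @` C `&` h @` D = set0).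

Let part (S : set baire_space) n (a : baire_space) := h @` (S `&` [set b | agree n a b]).

Let nonsep n (p : baire_space * baire_space) :=
  ~ borel_separated (part C n p.1) (part D n p.2).

Let upd (a : baire_space) n i : baire_space := fun k => if k == n then i else a k.

Let agree_upd a n i : agree n a (upd a n i).
Proof. by move=> k kn; rewrite /upd ltn_eqF. Qed.

Let part_bigcup S n a : part S n a = \bigcup_i part S n.+1 (upd a n i).
Proof.
apply/seteqP; split=> [_ [b [Sb ab] <-]|_ [i _ [b [Sb ab] <-]]].
  exists (b n) => //; exists b => //; split=> // k; rewrite ltnS /upd.
  by have [->//|kn] := eqVneq k n; rewrite leq_eqVlt (negbTE kn) => /ab.
exists b => //; split=> //=.
exact: agree_trans (@agree_upd a n i) (agree_le (leqnSn n) ab).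
Qed.

(** If all the refinements by one more digit were separated, [borel_separated_bigcup] would separate
    the pieces of stage [n]. The existential stands outside the implication so that choice gives a
    total function. *)
Let nonsepS n p : exists q, nonsep n p ->
  [/\ agree n p.1 q.1, agree n p.2 q.2 & nonsep n.+1 q].
Proof.
have [np|] := pselect (nonsep n p); last by exists p.
have [[i j] ij] : exists ij, nonsep n.+1 (upd p.1 n ij.1, upd p.2 n ij.2).
  apply: contrapT => /forallNP H; apply: np; rewrite !part_bigcup.
  by apply: borel_separated_bigcup => i j; exact: (contrapT (H (i, j))).
by exists (upd p.1 n i, upd p.2 n j) => _; split => //; exact: agree_upd.
Qed.

Let closed_limit (S : set baire_space) a : closed S ->
  (forall n, exists2 b, S b & agree n a b) -> S a.
Proof.
move=> cS H; apply: cS => U /(@nbhs_seqP nat)[n nU].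
by have [b Sb ab] := H n; exists b; split => //; exact: nU.
Qed.

(** Inseparable pieces of inseparable images shrink to two branches [a] and [b]. Such pieces are
    nonempty, so closedness puts [a] in [C] and [b] in [D]; then [h a != h b], and by continuity
    disjoint open sets around these values separate a late pair of pieces. *)
Lemma closed_images_separated : borel_separated (h @` C) (h @` D).
Proof.
apply: contrapT => nsep.
have [g gP] : exists g : nat -> baire_space * baire_space -> baire_space * baire_space,
    forall n p, nonsep n p ->
    [/\ agree n p.1 (g n p).1, agree n p.2 (g n p).2 & nonsep n.+1 (g n p)].
  have /choice[g gP] (np : nat * (baire_space * baire_space)) :=
    nonsepS np.1 np.2.
  by exists (fun n p => g (n, p)) => n p; exact: (gP (n, p)).
pose s := fix s n := if n is m.+1 then g m (s m) else (point, point).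
have ns n : nonsep n (s n).
  elim: n => [|n /gP[]//]; rewrite /nonsep /part.
  rewrite (_ : [set b | agree 0 (s 0).1 b] = setT); last by apply/seteqP; split.
  by rewrite !setIT.
pose a : baire_space := fun k => (s k.+1).1 k.
pose b : baire_space := fun k => (s k.+1).2 k.
have sS m n : (m <= n)%N -> agree m (s m).1 (s n).1 /\ agree m (s m).2 (s n).2.
  move=> /subnKC <-; elim: (n - m)%N => [|k [IH1 IH2]]; first by rewrite addn0.
  rewrite addnS; have [] := gP _ _ (ns (m + k)%N); rewrite -/(s (m + k).+1).
  move=> /(agree_le (leq_addr k m)) h1 /(agree_le (leq_addr k m)) h2 _.
  by split; [exact: agree_trans IH1 h1|exact: agree_trans IH2 h2].
have sa n : agree n a (s n).1 by move=> k kn; have [/(_ k (leqnn _)) ->] := sS _ _ kn.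
have sb n : agree n b (s n).2 by move=> k kn; have [_ /(_ k (leqnn _)) ->] := sS _ _ kn.
have Ca : C a.
  apply: closed_limit => // n; apply: contrapT => H; apply: (ns n).
  exists set0; split; [exact: borel0| |exact: set0I].
  by move=> _ [c [Cc sc] <-]; apply: H; exists c => //; exact: agree_trans (sa n) sc.
have Db : D b.
  apply: closed_limit => // n; apply: contrapT => H; apply: (ns n).
  exists setT; split; [exact/borel_open/openT|by []|].
  rewrite setTI -subset0 => _ [c [Dc sc] <-]; apply: H.
  by exists c => //; exact: agree_trans (sb n) sc.
have hab : h a != h b.
  apply/eqP => hab; suff : set0 (h a) by [].
  by rewrite -CD0; split; [exists a|exists b].
have H := hT; rewrite open_hausdorff in H.
have [[U V] /= [Ua Vb] [oU oV UV0]] := H _ _ hab.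
have [n nU] := (@continuous_seqP nat _ _).1 ch a U oU (set_mem Ua).
have [m mV] := (@continuous_seqP nat _ _).1 ch b V oV (set_mem Vb).
apply: (ns (maxn n m)); exists U; split; first exact: borel_open.
  move=> _ [c [_ sc] <-]; apply: nU.
  exact: agree_le (leq_maxl n m) (agree_trans (sa _) sc).
rewrite -subset0 => x [Uc [c [_ sc] e]]; rewrite -(eqP UV0); split; first exact: Uc.
rewrite -e; apply: mV; exact: agree_le (leq_maxr n m) (agree_trans (sb _) sc).
Qed.

End LusinSeparation.

Section PolishBorel.
Variables (R : realType) (T : topologicalType).
Hypothesis pT : polish R T.

Lemma suslin_separation (A B : set T) : suslin A -> suslin B ->
  A `&` B = set0 -> borel_separated A B.
Proof.
move=> [F [cF AF]] [G [cG BG]] AB0.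
have [[x0 _]|noT] := pselect (exists y : T, True); last first.
  by exists set0; split; [exact: borel0| |exact: set0I] => x; case: noT; exists x.
have [f [cf fT]] := polish_baire_image x0 pT.
(* The [false] strand codes a point of [T] and the [true] strand a witness for [F] or [G]; thus both
   sets become images of closed sets under the same map [h]. *)
pose h (c : baire_space) := f (strand false c).
have ch : continuous h := continuous_compose (@strand_continuous _ _) cf.
have im (S : set T) (H : set (baire_space * T)) :
    (forall x, S x <-> exists a, H (a, x)) ->
    S = h @` [set c | H (strand true c, h c)].
  move=> SH; apply/seteqP; split=> x.
    move=> /SH[a Hax]; have [b bx] := fT x.
    exists (@braid bool (fun i : bool => if i then a else b));
      by rewrite /h /= !strand_braid bx.
  by move=> [c /= Hc <-]; apply/SH; exists (strand true c).
rewrite (im A F) // (im B G) //; apply: closed_images_separated => //.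
- exact: polish_hausdorff pT.
- exact: closed_continuous_preimage (continuous_pair (@strand_continuous _ true) ch) cF.
- exact: closed_continuous_preimage (continuous_pair (@strand_continuous _ true) ch) cG.
- by rewrite -(im A F) // -(im B G).
Qed.

Lemma suslin_open (U : set T) : open U -> suslin U.
Proof.
have [d [[ax oT _] _]] := polish_metric pT => oU.
pose F n := [set x | forall y, ~ U y -> eps R n <= d x y].
rewrite (_ : U = [set x | exists n, F n x]).
  apply: suslin_exists => n; apply: suslin_closed; rewrite -openC; apply/oT => x.
  move=> /existsNP[y /not_implyP[Uy /negP]]; rewrite -ltNge => xy.
  exists (eps R n - d x y); first lra.
  move=> z xz /(_ y Uy); rewrite leNgt => /negP; apply.
  by have := dist_triangle ax x z y; rewrite (dist_sym ax z x); lra.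
apply/seteqP; split=> x.
  move=> Ux; have [e /eps_lt[n ne] eU] := (oT U).1 oU x Ux.
  exists n => y; apply: contra_notT; rewrite -ltNge => xy; apply: eU.
  exact: lt_trans ne.
move=> [n Fx]; apply: contrapT => /Fx; rewrite dist_xx // leNgt.
by rewrite eps_gt0.
Qed.

Lemma borel_suslin (E : set T) : borel E -> suslin E /\ suslin (~` E).
Proof.
elim=> [U oU|F _ [sF sCF]|F _ H].
- split; first exact: suslin_open.
  by apply: suslin_closed; rewrite closedC.
- by rewrite setCK.
- rewrite setC_bigcup; split.
    rewrite (_ : \bigcup_n F n = [set x | exists n, F n x]).
      by apply: suslin_exists => n; case: (H n).
    by apply/seteqP; split=> x [n]; [exists n|exists n].
  rewrite (_ : \bigcap_n ~` F n = [set x | forall n, (~` F n) x]).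
    by apply: suslin_forall => n; case: (H n).
  by apply/seteqP; split=> x Fx n; [exact: Fx|move=> _; exact: Fx].
Qed.

Lemma bisuslin_borel (E : set T) : suslin E -> suslin (~` E) -> borel E.
Proof.
move=> sE sCE; have [|F [bF EF FE]] := suslin_separation sE sCE.
  exact: setICr.
rewrite (_ : E = F) //; apply/seteqP; split=> // x Fx.
apply: contrapT => Ex; suff : set0 x by [].
by rewrite -FE.
Qed.

End PolishBorel.

(** * Refining a Polish topology *)

Section TameSets.
Variables (R : realType) (T : topologicalType).

(* The graph of [x |-> (h n x)_n] is sequentially closed in [T * R^nat], so that
   [T] remains Polish once all the [h n] are made continuous. *)
Definition closed_graph (h : nat -> T -> R) : Prop :=
  forall (u : nat -> T) (x : T), u @ \oo --> x ->
    (forall n, cvgn (h n \o u)) -> forall n, h n \o u @ \oo --> h n x.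

(** Only [h 0] is prescribed. The other functions are auxiliary: requiring them to converge along a
    sequence is what forces the indicator of [E] to pass to the limit. *)
Definition tame (E : set T) : Prop :=
  exists2 h, closed_graph h & forall x, h 0%N x = \1_E x.

Lemma cvg_nat_eventually (v : nat -> nat) : cvgn (fun n => (v n)%:R : R) ->
  exists N, forall n, (N <= n)%N -> v n = v N.
Proof.
move=> /cvg_ex[/= l /cvgrPdist_lt vl].
have [N _ HN] := vl (2^-1 : R) ltac:(by rewrite invr_gt0).
exists N => n Nn; have := HN n Nn; have := HN N (leqnn N) => /=.
rewrite !ltr_distl => /andP[h1 h2] /andP[h3 h4] {vl HN}.
have [h|h|//] := ssrnat.ltngtP (v n) (v N); exfalso.
  have : (v n)%:R + 1 <= (v N)%:R :> R by rewrite natr1 ler_nat.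
  by lra.
have : (v N)%:R + 1 <= (v n)%:R :> R by rewrite natr1 ler_nat.
by lra.
Qed.

Lemma cvg_eventually_eq (v : nat -> R) (l : R) N :
  (forall n, (N <= n)%N -> v n = l) -> v @ \oo --> l.
Proof. by move=> H; apply: cvg_near_cst; exists N => // n /H ->. Qed.

Lemma cvg_indic_eventually (E : set T) (u : nat -> T) x :
  (\1_E \o u : nat -> R) @ \oo --> (\1_E x : R) ->
  exists N, forall n, (N <= n)%N -> E (u n) <-> E x.
Proof.
move=> /cvgrPdist_lt/(_ 1 ltr01)[N _ HN]; exists N => n /HN /=.
rewrite !indicE -(in_setE E (u n)) -(in_setE E x).
case: (x \in E); case: (u n \in E) => //=.
  by rewrite subr0 normr1 ltxx.
by rewrite sub0r normrN normr1 ltxx.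
Qed.

Lemma tame_compl E : tame E -> tame (~` E).
Proof.
move=> [h hg h0]; have nE x : \1_(~` E) x = 1 - \1_E x :> R.
  by rewrite !indicE in_setC; case: (x \in E); rewrite ?subrr ?subr0.
exists (fun n => if n is m.+1 then h m else \1_(~` E)) => // u x ux uh.
have H := hg u x ux (fun n => uh n.+1).
case=> [|n]; last exact: H.
rewrite nE -h0 (_ : _ \o u = fun n => 1 - (h 0%N \o u) n).
  by apply: cvgB; [exact: cvg_cst|exact: H].
by apply/funext => n /=; rewrite nE h0.
Qed.

Lemma tame_bigcup (E : nat -> set T) : (forall n, tame (E n)) -> tame (\bigcup_n E n).
Proof.
move=> tE; have /choice[h hP] n : exists h, closed_graph h /\ forall x, h 0%N x = \1_(E n) x.
  by have [h] := tE n; exists h.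
(* The least index [M x] of a set containing [x] is eventually constant along [u],
   and the indicators of the [E n] pass its value to the limit. *)
pose first x k := if k is m.+1 then E m x /\ forall i, (i < m)%N -> ~ E i x
  else forall i, ~ E i x.
have first_inj x k l : first x k -> first x l -> k = l.
  case: k l => [|k] [|l] //=; first by move=> H [/H].
    by move=> [Ek _] /(_ k).
  move=> [Ek Hk] [El Hl]; have [kl|lk|-> //] := ssrnat.ltngtP k l.
    by have := Hl _ kl.
  by have := Hk _ lk.
have /choice[M MP] x : exists k, first x k.
  have [[n En]|H] := pselect (exists n, E n x); last first.
    by exists 0%N => i Ei; apply: H; exists i.
  have ex : exists n, `[< E n x >] by exists n; apply/asboolP.
  exists (ex_minn ex).+1; case: ex_minnP => m /asboolP Em Hm; split=> // i im.
  by move=> /asboolP/Hm; rewrite leqNgt im.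
pose g (n : nat) (x : T) : R := match n with
  | 0%N => \1_(\bigcup_n E n) x
  | 1%N => (M x)%:R
  | k.+2 => if unpickle k is Some (i, j) then h i j x else 0 end.
have M0 x : \1_(\bigcup_n E n) x = (M x != 0%N)%:R :> R.
  rewrite indicE; congr (nat_of_bool _)%:R; apply/idP/idP; rewrite inE.
    by move=> [i _ Ei]; apply/eqP => M0; have := MP x; rewrite M0 => /(_ i Ei).
  by case: (M x) (MP x) => // k [Ek _] _; exists k.
exists g => // u x ux ug.
have hij i j : h i j \o u @ \oo --> h i j x.
  apply: (hP i).1 => // {}j; have := ug (pickle (i, j)).+2.
  by rewrite /g pickleK.
have [N NP] : exists N, forall n, (N <= n)%N -> M (u n) = M (u N).
  exact: cvg_nat_eventually (ug 1%N).
have ev i : exists N', forall n, (N' <= n)%N -> E i (u n) <-> E i x.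
  apply: cvg_indic_eventually; rewrite -(hP i).2.
  rewrite (_ : _ \o u = h i 0%N \o u); first exact: hij.
  by apply/funext => n /=; rewrite (hP i).2.
have evM i : exists2 n, M (u n) = M (u N) & E i (u n) <-> E i x.
  have [N' HN'] := ev i; exists (maxn N N'); first exact/NP/leq_maxl.
  exact/HN'/leq_maxr.
have Mx : M x = M (u N).
  apply: (first_inj x) (MP x) _; case e : (M (u N)) => [|m] /=.
    move=> i; have [n Mn <-] := evM i; have := MP (u n); rewrite Mn e; exact.
  split.
    by have [n Mn <-] := evM m; have := MP (u n); rewrite Mn e => -[].
  move=> i im; have [n Mn <-] := evM i.
  by have := MP (u n); rewrite Mn e => -[_]; exact.
case=> [|[|k]] /=.
- rewrite M0 Mx; apply: (@cvg_eventually_eq _ _ N) => n Nn /=.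
  by rewrite M0 NP.
- rewrite Mx; apply: (@cvg_eventually_eq _ _ N) => n Nn /=.
  by rewrite NP.
- rewrite /g /comp /=; case: unpickle => [[i j]|]; [exact: hij|exact: cvg_cst].
Qed.

Lemma tame_pos (phi : T -> R) : continuous phi -> tame [set x | 0 < phi x].
Proof.
move=> cphi; set E := mkset _.
(* The inverse of [phi] blows up along a sequence in [E] on which [phi] tends to 0; its convergence
   therefore prevents the limit from leaving [E]. *)
exists (fun n x => if n is 0%N then \1_E x else if 0 < phi x then (phi x)^-1 else 0) => //.
move=> u x ux uh.
have phiu : phi \o u @ \oo --> phi x by apply: continuous_cvg => //; exact: cphi.
have [N NP] : exists N, forall n, (N <= n)%N -> (u n \in E : nat) = (u N \in E).
  exact: cvg_nat_eventually (uh 0%N).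
have EP y : (y \in E) = (0 < phi y) by apply/idP/idP; rewrite inE.
have [uN|uN] := boolP (u N \in E); last first.
  have Hn n : (N <= n)%N -> (u n \in E) = false.
    by move=> /NP; rewrite (negbTE uN); case: (u n \in E).
  have phix : (0 < phi x) = false.
    apply/negbTE/negP => px; have [M _ HM] := cvgr_gt _ phiu _ px.
    have := HM _ (leq_maxr N M); have := Hn _ (leq_maxl N M).
    by rewrite EP /= => ->.
  case=> [|n].
    rewrite indicE EP phix; apply: (@cvg_eventually_eq _ _ N) => n Nn /=.
    by rewrite indicE Hn.
  rewrite phix; apply: (@cvg_eventually_eq _ _ N) => k Nk /=.
  by rewrite -EP Hn.
have Hn n : (N <= n)%N -> 0 < phi (u n).
  by move=> /NP; rewrite uN -EP; case: (u n \in E).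
have phix : 0 < phi x.
  have : 0 <= phi x.
    rewrite leNgt; apply/negP => px; have [M _ HM] := cvgr_lt _ phiu _ px.
    have := HM _ (leq_maxr N M); have := Hn _ (leq_maxl N M).
    by rewrite /=; lra.
  rewrite le_eqVlt => /predU1P[phi0|//].
  have /cvg_ex[/= l wl] := uh 1%N.
  pose g n := (phi \o u) n * ((fun y => if 0 < phi y then (phi y)^-1 else 0) \o u) n.
  have g0 : g @ \oo --> (0 : R) by rewrite -(mul0r l) [X in X * l]phi0; exact: cvgM.
  have g1 : g @ \oo --> (1 : R).
    apply: (@cvg_eventually_eq _ _ N) => n /Hn pn.
    by rewrite /g /= pn divff // gt_eqF.
  have /eqP : 0 = 1 :> R by apply: (@cvg_unique R (@norm_hausdorff R R) (g @ \oo)).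
  by rewrite eq_sym oner_eq0.
case=> [|n].
  rewrite indicE EP phix; apply: (@cvg_eventually_eq _ _ N) => n /Hn pn /=.
  by rewrite indicE EP pn.
rewrite phix; apply: cvg_trans (cvgV _ phiu); last by rewrite gt_eqF.
by apply: near_eq_cvg; exists N => // k /= /Hn ->.
Qed.

End TameSets.

Lemma cauchy_real_cvg (R : realType) (v : nat -> R) :
  (forall e : R, 0 < e ->
    exists N, forall i j, (N <= i)%N -> (N <= j)%N -> `|v i - v j| < e) ->
  cvgn v.
Proof.
move=> H; apply/cauchy_cvgP/cauchy_ballP => e /H[N NP].
exists (v @` [set k | (N <= k)%N], v @` [set k | (N <= k)%N]) => /=.
  by split; exists N => // k Nk; exists k.
by move=> [_ _] [[i /= Ni <-] [j /= Nj <-]]; exact: NP.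
Qed.

Section BorelTame.
Variables (R : realType) (T : topologicalType) (d : T -> T -> R).
Hypothesis cm : complete_metric d.

Let ax := cm_axioms cm.

(* The supremum of [inside U x] is 1-Lipschitz in [x] and positive exactly on [U],
   even when [U] is the whole space and has no complement to be distant from. *)
Let inside (U : set T) x : set R :=
  [set r | 0 <= r <= 1 /\ forall y, d x y < r -> U y].

Let inside0 U x : inside U x 0.
Proof.
split=> [|y]; first by rewrite lexx ler01.
by rewrite ltNge dist_ge0.
Qed.

Let inside_sup U x r : inside U x r -> r <= sup (inside U x).
Proof.
by move=> ir; apply: ub_le_sup => //; exists 1 => s [/andP[]].
Qed.

Let inside_lipschitz U x y : sup (inside U x) <= sup (inside U y) + d x y.
Proof.
apply: ge_sup; first by exists 0; exact: inside0.
move=> r [/andP[r0 r1] Ur]; rewrite -lerBlDr.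
have [h|h] := leP (r - d x y) 0; first by rewrite (le_trans h) // inside_sup.
have dxy : 0 <= d x y by exact: dist_ge0.
apply: inside_sup; split; first by apply/andP; split; lra.
by move=> z yz; apply: Ur; have := dist_triangle ax y x z; lra.
Qed.

Lemma lipschitz_continuous (phi : T -> R) :
  (forall x y, phi x <= phi y + d x y) -> continuous phi.
Proof.
move=> H x; apply/cvgrPdist_lt => e e0; apply: open_nbhs_nbhs.
split; last by rewrite subrr normr0.
apply/(cm_open cm) => y /= ye; exists (e - `|phi x - phi y|); first by rewrite subr_gt0.
move=> z yz; have : `|phi y - phi z| <= d y z.
  rewrite ler_norml; have := H y z; have := H z y; rewrite (dist_sym ax z y).
  by move=> h1 h2; apply/andP; split; lra.
have := ler_distD (phi y) (phi x) (phi z); lra.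
Qed.

Lemma borel_tame (E : set T) : borel E -> tame R E.
Proof.
elim=> [U oU|F _ tF|F _ tF]; [|exact: tame_compl|exact: tame_bigcup].
pose phi x := sup (inside U x).
rewrite (_ : U = [set x | 0 < phi x]).
  exact/tame_pos/lipschitz_continuous/inside_lipschitz.
apply/seteqP; split=> x /=.
  move=> /((cm_open cm U).1 oU)[e e0 eU].
  apply: (@lt_le_trans _ _ (Num.min e 1)); first by rewrite lt_min e0 ltr01.
  apply: inside_sup; split; first by rewrite le_min (ltW e0) ler01 /= ge_min lexx orbT.
  by move=> y; rewrite lt_min => /andP[/eU].
rewrite /phi => /sup_gt; case; first by exists 0; exact: inside0.
by move=> r [_ rU] r0; apply: rU; rewrite dist_xx.
Qed.

End BorelTame.

Section Refinement.
Variables (R : realType) (T : topologicalType) (d : T -> T -> R) (h : nat -> T -> R).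
Hypotheses (cm : complete_metric d) (hg : closed_graph h).

Let ax := cm_axioms cm.

(** A metric of [R^nat] pulled back by the functions [h n]. Truncating coordinate [n] at [eps R n]
    bounds the supremum and leaves finitely many coordinates to control at each precision; [rdist]
    is then the metric of the graph. *)
Let gap x y n := Num.min (eps R n) `|h n x - h n y|.
Let hdist x y := sup (range (gap x y)).
Let rdist x y := d x y + hdist x y.

Let gap_ge0 x y n : 0 <= gap x y n.
Proof. by rewrite /gap le_min normr_ge0 (ltW (eps_gt0 R n)). Qed.

Let gap_le_hdist x y n : gap x y n <= hdist x y.
Proof.
apply: ub_le_sup; last by exists n.
exists (eps R 0) => _ [m _ <-]; rewrite /gap ge_min eps_le //.
Qed.

Let hdist_le x y e : (forall n, gap x y n <= e) -> hdist x y <= e.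
Proof.
by move=> H; apply: ge_sup; [exists (gap x y 0), 0%N|move=> _ [n _ <-]].
Qed.

Let hdist_ge0 x y : 0 <= hdist x y.
Proof. exact: le_trans (gap_ge0 x y 0) (gap_le_hdist x y 0). Qed.

Let rdist_axioms : metric_axioms rdist.
Proof.
split.
- move=> x; rewrite /rdist dist_xx // add0r; apply/eqP; rewrite eq_le hdist_ge0 andbT.
  by apply: hdist_le => n; rewrite /gap subrr normr0 ge_min lexx orbT.
- move=> x y rxy; apply/(dist_eq0 ax)/eqP; rewrite eq_le dist_ge0 // andbT.
  by have := hdist_ge0 x y; rewrite /rdist in rxy; lra.
- move=> x y; rewrite /rdist (dist_sym ax); congr (_ + sup _).
  by apply: eq_imagel => n _; rewrite /gap distrC.
- move=> y x z; rewrite /rdist addrACA lerD ?(dist_triangle ax) //.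
  apply: hdist_le => n.
  apply: le_trans (lerD (gap_le_hdist x y n) (gap_le_hdist y z n)).
  have := ler_distD (h n y) (h n x) (h n z); have := eps_gt0 R n.
  rewrite /gap; move: `|h n x - h n z| `|h n x - h n y| `|h n y - h n z| (eps R n)
    (normr_ge0 (h n x - h n y)) (normr_ge0 (h n y - h n z)) => a b c e.
  by rewrite /Num.min; do !case: ifPn => ?; lra.
Qed.

Let tX := metric_topology rdist_axioms.
Local Notation T' := (Topological.Pack tX).

Let dist_cvg_topology u x : dist_cvg d u x -> u @ \oo --> x.
Proof.
move=> ux U; rewrite nbhsE => -[V [oV Vx] VU].
have [e e0 eV] := (cm_open cm V).1 oV x Vx.
have [N NP] := ux e e0; exists N => // n /NP /= un; apply/VU/eV.
by rewrite (dist_sym ax).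
Qed.

(** A Cauchy sequence for [rdist] converges for [d], and each [h n] converges along it in [R];
    [closed_graph] identifies these limits with the values at the limit point. *)
Let rdist_complete u : dist_cauchy rdist u -> exists l, dist_cvg rdist u l.
Proof.
move=> cu; have [|x ux] := cm_complete cm (u := u).
  move=> e /cu[N NP]; exists N => m n Nm Nn.
  by apply: le_lt_trans (NP m n Nm Nn); rewrite /rdist lerDl.
have hu n : h n \o u @ \oo --> h n x.
  apply: (hg (dist_cvg_topology ux)) => {}n; apply: cauchy_real_cvg => e e0.
  have [N NP] := cu (Num.min e (eps R n)) ltac:(by rewrite lt_min e0 eps_gt0).
  exists N => i j Ni Nj; have := NP i j Ni Nj.
  have := gap_le_hdist (u i) (u j) n; have := dist_ge0 (u i) (u j) ax.
  rewrite /rdist /gap /= /Num.min; do !case: ifPn => ?; lra.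
exists x => e e0; have [N NP] := cu (e / 3) ltac:(lra).
have [M MP] := ux (e / 3) ltac:(lra).
exists (maxn N M) => n; rewrite geq_max => /andP[Nn Mn].
suff : hdist (u n) x <= e / 3 by have := MP n Mn; rewrite /rdist; lra.
apply: hdist_le => i; apply/ler_addgt0Pl => c c0.
have /cvgrPdist_lt/(_ c c0)[L _ LP] := hu i.
have := LP _ (leq_maxr N L); have := NP n _ Nn (leq_maxl N L).
set m := maxn N L => h1 /= h2.
have := gap_le_hdist (u n) (u m) i; have := dist_ge0 (u n) (u m) ax.
move: h1; rewrite /rdist /gap; move: h2; rewrite distrC.
have := ler_distD (h i (u m)) (h i (u n)) (h i x).
rewrite /Num.min; do !case: ifPn => ?; lra.
Qed.

Lemma closed_graph_refinement (S : set T) : countable S -> dist_dense d S ->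
  exists tX : Topological T, [/\ polish R (Topological.Pack tX), finer tX &
    forall n (E : set T), (forall x, h n x = \1_E x) ->
      open (E : set (Topological.Pack tX))].
Proof.
move=> /countable_injP[f fI] dS; exists tX; split.
- have /choice[near nearP] (nx : nat * T) : exists y, S y /\ d nx.2 y < eps R nx.1.
    by have [y Sy yx] := dS nx.2 _ (eps_gt0 R nx.1); exists y.
  (* Equal codes mean a common dense point within [eps R n] and, for each of the first [n]
     functions, values in a common interval of length [eps R n]; hence a distance below
     [3 * eps R n]. *)
  pose code n x := (f (near (n, x)), mkseq (fun j => Num.floor (h j x / eps R n)) n).
  have [|S' cS' dS'] := @dense_of_codes R T _ rdist code.
    move=> e e0; have [n ne] := @eps_lt R (e / 3) ltac:(lra).
    exists n => x y [fxy hxy].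
    have exy : near (n, x) = near (n, y).
      by apply: fI => //; rewrite inE; case: (nearP (n, x)); case: (nearP (n, y)).
    have hd : hdist x y <= eps R n.
      apply: hdist_le => j; rewrite /gap ge_min.
      have [nj|jn] := leqP n j; first by rewrite eps_le.
      apply/orP; right.
      have fj : Num.floor (h j x / eps R n) = Num.floor (h j y / eps R n).
        by move/(congr1 (nth 0 ^~ j)): hxy; rewrite !nth_mkseq.
      have en := eps_gt0 R n; have ediv z : h j z = h j z / eps R n * eps R n.
        by rewrite divfK // gt_eqF.
      rewrite (ediv x) (ediv y) -mulrBl normrM (gtr0_norm en) ler_piMl ?(ltW en) //.
      move: (h j x / _) (h j y / _) fj => a b ab.
      have := ge_floor a; have := floorD1_gt a; have := ge_floor b; have := floorD1_gt b.
      rewrite ab !intrD; move: (Num.floor b)%:~R => c.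
      by move=> *; rewrite ler_norml; apply/andP; split; lra.
    have [/= _ h1] := nearP (n, x); have [/= _ h2] := nearP (n, y).
    rewrite /rdist; have := dist_triangle ax (near (n, x)) x y.
    rewrite {2}exy (dist_sym ax (near _) y); lra.
  apply: (@metric_polish R T' rdist S') => //; split; [exact: rdist_axioms| |exact: rdist_complete].
  exact: metric_topologyP.
- move=> U /(cm_open cm) oU; apply/metric_topologyP => x /oU[e e0 eU].
  exists e => // y xy; apply: eU; apply: le_lt_trans xy.
  by rewrite /rdist lerDl.
- move=> n E hE; apply/metric_topologyP => x Ex.
  (* Across the boundary of [E] the indicator jumps by 1, so the gap of index [n] equals this radius
     and the ball cannot leave [E]. *)
  exists (Num.min (eps R n) 1); first by rewrite lt_min eps_gt0 ltr01.
  move=> y xy; apply: contrapT => Ey.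
  have := gap_le_hdist x y n; have := dist_ge0 x y ax; move: xy.
  have -> : gap x y n = Num.min (eps R n) 1.
    by rewrite /gap !hE !indicE (mem_set Ex) (memNset Ey) subr0 normr1.
  by rewrite /rdist; lra.
Qed.

End Refinement.

(** The witnesses of tameness of all the [E n] are interleaved into one family, so that a single
    refinement opens every set. *)
Lemma polish_refinement (R : realType) (T : topologicalType) (E : nat -> set T) :
  polish R T -> (forall n, borel (E n)) ->
  exists tX : Topological T, [/\ polish R (Topological.Pack tX), finer tX &
    forall n, open (E n : set (Topological.Pack tX))].
Proof.
move=> /polish_metric[d [cm [S cS dS]]] bE.
have /choice[h hP] n : exists h, closed_graph h /\ forall x, h 0%N x = \1_(E n) x :> R.
  by have [h] := borel_tame cm (bE n); exists h.
pose g n x := if unpickle n is Some (i, j) then h i j x else 0.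
have gg : closed_graph g.
  move=> u x ux ug n; rewrite /g /comp; case: unpickle => [[i j]|]; last exact: cvg_cst.
  apply: (hP i).1 => // {}j; have := ug (pickle (i, j)).
  by rewrite /g /comp pickleK.
have [tX [pX fX oX]] := closed_graph_refinement cm gg cS dS.
exists tX; split => // n; apply: (oX (pickle (n, 0%N))) => x.
by rewrite /g pickleK (hP n).2.
Qed.

(** * Baire category on the Cantor space *)

Section CantorCategory.
Implicit Types (w s t : bitseq) (a : cantor_space) (M E : set cantor_space).

Definition cyl w : set cantor_space := [set a | mkseq a (size w) = w].

Lemma cylP w a : cyl w a <-> forall i, (i < size w)%N -> a i = nth false w i.
Proof.
split=> [wa i iw|H]; first by rewrite -[in RHS]wa nth_mkseq.
by apply: (@eq_from_nth _ false); rewrite size_mkseq // => i iw; rewrite nth_mkseq ?H.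
Qed.

Lemma cyl_cat w t a : cyl (w ++ t) a -> cyl w a.
Proof.
move/cylP=> H; apply/cylP => i iw; rewrite H ?nth_cat ?iw //.
by rewrite size_cat ltn_addr.
Qed.

Lemma cyl_prepend w v a : cyl v a -> cyl (w ++ v) (prepend w a).
Proof.
move/cylP=> H; apply/cylP => i; rewrite size_cat /prepend nth_cat => iwv.
case: ltnP => // wi; apply: H; lia.
Qed.

Lemma cyl_open w : open (cyl w).
Proof.
apply/(@open_seqP bool) => a /cylP wa; exists (size w) => b ab.
by apply/cylP => i iw; rewrite ab ?wa.
Qed.

Lemma open_cyl (U : set cantor_space) a : open U -> U a ->
  exists n, cyl (mkseq a n) `<=` U.
Proof.
move=> /(@open_seqP bool) H /H[n nU]; exists n => b /cylP ab; apply: nU => i lein.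
by rewrite ab ?size_mkseq ?nth_mkseq.
Qed.

Definition nowhere_dense M : Prop :=
  forall w, exists t, cyl (w ++ t) `&` M = set0.

Definition meager M : Prop :=
  exists2 N : nat -> set cantor_space,
    forall n, nowhere_dense (N n) & M `<=` \bigcup_n N n.

Lemma nowhere_dense0 : nowhere_dense set0.
Proof. by move=> w; exists [::]; rewrite setI0. Qed.

Lemma nowhere_dense_meager M : nowhere_dense M -> meager M.
Proof. by move=> nM; exists (fun=> M) => // a Ma; exists 0%N. Qed.

Lemma meager_sub M M' : M `<=` M' -> meager M' -> meager M.
Proof. by move=> MM' [N nN M'N]; exists N => //; exact: subset_trans M'N. Qed.

Lemma meager_bigcup (I : countType) (M : I -> set cantor_space) :
  (forall i, meager (M i)) -> meager (\bigcup_i M i).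
Proof.
move=> mM; have /choice[N NP] i : exists N : nat -> set cantor_space,
    (forall n, nowhere_dense (N n)) /\ M i `<=` \bigcup_n N n.
  by have [N] := mM i; exists N.
exists (fun k => if unpickle k is Some (i, n) then N i n else set0).
  by move=> k; case: unpickle => [[i n]|]; [exact: (NP i).1|exact: nowhere_dense0].
move=> a [i _ /(NP i).2[n _ Na]]; exists (pickle (i, n)) => //.
by rewrite pickleK.
Qed.

Lemma meagerU M M' : meager M -> meager M' -> meager (M `|` M').
Proof.
move=> mM mM'; apply: meager_sub (_ : meager (\bigcup_(b : bool) if b then M else M')).
  by move=> a [Ma|M'a]; [exists true|exists false].
by apply: meager_bigcup; case.
Qed.

Lemma cantor_baire M w : meager M -> exists2 a, cyl w a & ~ M a.
Proof.
move=> [N /(_ _) nN MN].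
have /choice[t tP] (nw : nat * bitseq) : exists t, cyl (nw.2 ++ t) `&` N nw.1 = set0.
  exact: nN.
(* The trailing [false] makes [s n] at least [n] bits long even when the words [t] are empty, so
   that bit [k] of the limit can be read in [s k.+1]. *)
pose s := fix s n := if n is m.+1 then s m ++ t (m, s m) ++ [:: false] else w.
have size_s n : (n <= size (s n))%N.
  by elim: n => //= n IH; rewrite !size_cat /= addnA addn1 ltnS (leq_trans IH) ?leq_addr.
have s_pre m n : exists v, s (m + n)%N = s m ++ v.
  elim: n => [|n [v sv]]; first by exists [::]; rewrite addn0 cats0.
  by rewrite addnS /= sv -catA; eexists.
pose a : cantor_space := fun k => nth false (s k.+1) k.
have sa n : cyl (s n) a.
  apply/cylP => i iS; rewrite /a.
  have iS' := size_s i.+1.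
  have [v1 e1] := s_pre n i.+1; have [v2 e2] := s_pre i.+1 n.
  have : nth false (s (n + i.+1)%N) i = nth false (s (i.+1 + n)%N) i by rewrite addnC.
  by rewrite e1 e2 !nth_cat iS iS'.
exists a; first exact: (sa 0%N).
move=> /MN[n _ Na]; suff : set0 a by [].
by rewrite -(tP (n, s n)); split => //=; apply: (@cyl_cat _ [:: false]); rewrite -catA; exact: (sa n.+1).
Qed.

(** A local Banach category theorem. There are countably many cylinders in which [E] is meager, so
    the part of [E] inside them is meager; what they leave of [cyl s] is nowhere dense by
    hypothesis. *)
Lemma meager_local E s :
  (forall t, exists t', meager (cyl (s ++ t ++ t') `&` E)) -> meager (cyl s `&` E).
Proof.
move=> H; pose D t := meager (cyl t `&` E).
pose F t : set cantor_space := if pselect (D t) then cyl t `&` E else set0.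
have mF : meager (\bigcup_t F t).
  apply: meager_bigcup => t; rewrite /F; case: pselect => [Dt|nDt] //.
  exact/nowhere_dense_meager/nowhere_dense0.
apply: meager_sub (meagerU (nowhere_dense_meager
  (_ : nowhere_dense (cyl s `\` \bigcup_(t in D) cyl t))) mF).
  move=> a [sa Ea]; have [[t Dt ta]|nD] := pselect ((\bigcup_(t in D) cyl t) a).
    by right; exists t => //; rewrite /F; case: pselect.
  by left.
move=> w; have [[a wa sa]|nws] := pselect (exists2 a, cyl w a & cyl s a); last first.
  by exists [::]; rewrite cats0 -subset0 => a [wa [sa _]]; apply: nws; exists a.
have [r wr] : exists r, exists t, w ++ r = s ++ t.
  exists (mkseq (fun i => a (size w + i)%N) (size s)).
  exists (mkseq (fun i => a (size s + i)%N) (size w)).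
  have mk m n : mkseq a m ++ mkseq (fun i => a (m + i)%N) n = mkseq a (m + n).
    have -> : mkseq (fun i => a (m + i)%N) n = map a (iota m n).
      by rewrite -[in RHS](addn0 m) iotaDl -map_comp.
    by rewrite /mkseq iotaD map_cat.
  move: wa sa (mk (size w) (size s)) (mk (size s) (size w)).
  by rewrite /cyl /= => -> -> -> ->; rewrite addnC.
case: wr => t wr; have [t' Dt'] := H t.
exists (r ++ t'); rewrite -subset0 => b [wb [_ []]].
by exists (s ++ t ++ t') => //; rewrite catA -wr -catA.
Qed.

(** A local form of the Baire property: inside every cylinder there is one where [E] is comeager or
    meager. For a union, either some [F i] is comeager in a smaller cylinder, or each [F i] is
    meager in [cyl w] by [meager_local]. *)
Lemma borel_category E w : borel E ->
  exists t, meager (cyl (w ++ t) `\` E) \/ meager (cyl (w ++ t) `&` E).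
Proof.
have m0 M : M = set0 -> meager M.
  by move=> ->; exact/nowhere_dense_meager/nowhere_dense0.
move=> bE; elim: bE w => [U oU|F _ IH|F _ IH] w.
- have [[a wa Ua]|H] := pselect (exists2 a, cyl w a & U a); last first.
    by exists [::]; right; apply: m0; rewrite cats0 -subset0 => a [wa Ua]; apply: H; exists a.
  have [n nU] := open_cyl oU Ua.
  exists (mkseq (fun i => a (size w + i)%N) n); left; apply: m0.
  rewrite -subset0 => b [/cylP wb]; apply; apply: nU; apply/cylP => i.
  rewrite size_mkseq => lein; rewrite wb; last by rewrite size_cat size_mkseq; lia.
  have -> : nth false (mkseq a n) i = a i by rewrite nth_mkseq.
  rewrite nth_cat; case: ltnP => iw; first by rewrite (cylP w a).1.
  by rewrite nth_mkseq ?subnKC //; lia.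
- have [t [|] mt] := IH w; exists t; [right|left] => //.
  by rewrite setDE setCK.
- have [[i [t it]]|H] := pselect (exists i t, meager (cyl (w ++ t) `\` F i)).
    exists t; left; apply: meager_sub it; apply: setDS.
    by move=> a Fa; exists i.
  exists [::]; right; rewrite cats0 setI_bigcupr; apply: meager_bigcup => i.
  apply: meager_local => t; have [t' [mt'|mt']] := IH i (w ++ t).
    by exfalso; apply: H; exists i, (t ++ t'); rewrite catA.
  by exists t'; rewrite catA.
Qed.

Lemma meager_prepend M w : meager M -> meager (prepend w @^-1` M).
Proof.
move=> [N nN MN]; exists (fun n => prepend w @^-1` N n); last first.
  by move=> a /MN[n _ Na]; exists n.
move=> n s; have [t tN] := nN n (w ++ s); exists t.
rewrite -subset0 => a [/(cyl_prepend w) sa Na].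
by suff : set0 (prepend w a) by []; rewrite -tN; split => //; rewrite -catA.
Qed.

Lemma sword_dense w : exists n t, sword n = w ++ t.
Proof. by have [n <-] := psi_surj w; exists n, (nseq (n - size (psi n)) false). Qed.

(** Some [C i] is comeager in a cylinder [cyl w], and some [sword n] extends [w]. Both maps
    prepending [sword n] and one more bit pull meager sets back to meager sets, so one generic tail
    [g] puts both ends in [C i]. *)
Lemma borel_cover_edge (I : countType) (C : I -> set cantor_space) :
  (forall i, borel (C i)) -> (forall a, exists i, C i a) ->
  exists i n g, C i (prepend (rcons (sword n) false) g) /\
                C i (prepend (rcons (sword n) true) g).
Proof.
move=> bC cover.
have [[i [w mw]]|H] := pselect (exists i w, meager (cyl w `\` C i)); last first.
  have mC i : meager (cyl [::] `&` C i).
    apply: meager_local => t; have [t' [m|m]] := borel_category t (bC i).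
      by exfalso; apply: H; exists i, (t ++ t').
    by exists t'.
  have [a _ []] := cantor_baire [::] (meager_bigcup mC).
  by have [i Ca] := cover a; exists i.
have [n [t nw]] := sword_dense w; exists i, n.
have /(cantor_baire [::])[g _ gN] := meagerU
  (meager_prepend (rcons (sword n) false) mw) (meager_prepend (rcons (sword n) true) mw).
exists g; have wg b : cyl w (prepend (rcons (sword n) b) g).
  rewrite nw -cats1 -catA; apply: (@cyl_cat w (t ++ [:: b])).
  by rewrite -[X in cyl X]cats0; exact: cyl_prepend.
by split; apply: contrapT => Cg; apply: gN; [left|right]; split.
Qed.

End CantorCategory.

(** * The dichotomy *)

Lemma A1P (a b : cantor_space) : A1 (a, b) <->
  exists n, [/\ cyl (sword n) a, a n = false, b n = true & forall k, k != n -> b k = a k].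
Proof.
have sz n c : size (rcons (sword n) c) = n.+1 by rewrite size_rcons size_sword.
split=> [[n [g [-> ->]]]|[n [/cylP sa an bn ab]]]; exists n.
  split; [|by rewrite /prepend sz leqnn nth_rcons size_sword ltnn eqxx..|].
    apply/cylP => i; rewrite size_sword => lein.
    by rewrite /prepend sz leqW // nth_rcons size_sword lein.
  move=> k kn; rewrite /prepend !sz !nth_rcons size_sword (negbTE kn) ltnS.
  by rewrite leq_eqVlt (negbTE kn) /=; case: ifP.
exists (fun k => a (k + n.+1)%N).
suff H c (d : cantor_space) : d n = c -> (forall k, k != n -> d k = a k) ->
    d = prepend (rcons (sword n) c) (fun k => a (k + n.+1)%N).
  by congr pair; exact: H.
move=> dn da; apply/funext => k; rewrite /prepend sz nth_rcons size_sword ltnS.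
have [kn|nk] := leqP k n; last by rewrite subnK // da // gtn_eqF.
have [->|/[dup] kn' /da ->] := eqVneq k n; first by rewrite ltnn.
by rewrite ltn_neqAle kn' kn sa // size_sword ltn_neqAle kn' kn.
Qed.

Lemma A1_boundary : closure A1 `\` A1 = [set p | p.1 = p.2].
Proof.
have nb (a b : cantor_space) n : nbhs (a, b) (cyl (mkseq a n) `*` cyl (mkseq b n)).
  have H (c : cantor_space) : nbhs c (cyl (mkseq c n)).
    apply: open_nbhs_nbhs; split; first exact: cyl_open.
    by rewrite /cyl /= size_mkseq.
  by exists (cyl (mkseq a n), cyl (mkseq b n)) => //; split; exact: H.
have cylmk (c d : cantor_space) n i : cyl (mkseq c n) d -> (i < n)%N -> d i = c i.
  by move=> /cylP H lein; rewrite H ?nth_mkseq ?size_mkseq.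
apply/seteqP; split=> -[a b] /=.
  move=> [clA nA]; apply: contrapT => ab; apply: nA.
  have [m abm] : exists m, a m <> b m.
    by apply/existsNP => H; apply: ab; exact/funext.
  (* A pair of [A1] that agrees with [(a, b)] on the first [k > m] bits differs at [m], hence only
     there; this fixes its index independently of [k]. *)
  have E k : (m < k)%N -> [/\ cyl (sword m) a, a m = false, b m = true &
      forall i, (i < k)%N -> i != m -> b i = a i].
    move=> mk; have [[a' b'] [/A1P[n [sa an bn abn]] [/= aa bb]]] := clA _ (nb a b k).
    have nm : n = m.
      apply/eqP/negPn/negP; rewrite eq_sym => /abn ab'; apply: abm.
      by rewrite -(cylmk _ _ _ _ aa mk) -(cylmk _ _ _ _ bb mk).
    rewrite {n}nm in sa an bn abn; split.
    - apply/cylP => i im; rewrite -(cylmk _ _ _ _ aa); first by move/cylP: sa; apply.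
      by apply: ltn_trans mk; rewrite size_sword in im.
    - by rewrite -(cylmk _ _ _ _ aa).
    - by rewrite -(cylmk _ _ _ _ bb).
    - by move=> i ik /abn; rewrite (cylmk _ _ _ _ aa) ?(cylmk _ _ _ _ bb).
  apply/A1P; exists m; have [sa am bm _] := E m.+1 (leqnn _).
  split=> // k km; have [_ _ _] := E (maxn m k).+1 ltac:(by rewrite ltnS leq_maxl).
  by apply; rewrite ?ltnS ?leq_maxr.
move=> ->; split; last by move=> /A1P[n [_ -> ]].
move=> W [[U V] /= [/(@nbhs_seqP bool)[n nU] /(@nbhs_seqP bool)[m mV]] UVW].
have [k [t kt]] := sword_dense (mkseq b (maxn n m)).
pose g : cantor_space := fun=> false.
exists (prepend (rcons (sword k) false) g, prepend (rcons (sword k) true) g).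
split; first by exists k, g.
have H c : agree (maxn n m) b (prepend (rcons (sword k) c) g).
  move=> i im; apply: cylmk im.
  rewrite kt -cats1 -catA; apply: (@cyl_cat _ (t ++ [:: c])).
  by rewrite -[X in cyl X]cats0; exact: cyl_prepend.
apply: UVW; split => /=.
  by apply: nU; apply: agree_le (leq_maxl n m) (H _).
by apply: mV; apply: agree_le (leq_maxr n m) (H _).
Qed.

Lemma polish_base (R : realType) (T : topologicalType) : polish R T ->
  exists U : nat * nat -> set T, (forall i, open (U i)) /\
    forall x O, open O -> O x -> exists i, U i x /\ U i `<=` O.
Proof.
move=> /polish_metric[d [[ax oT _] [S /countable_injP[f fI] dS]]].
exists (fun ij => [set y | exists z, [/\ S z, f z = ij.1 & d z y < eps R ij.2]]).
split=> [[i j]|x O /oT oO /oO[e e0 eO]].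
  apply/oT => y /= [z [Sz fz zy]]; exists (eps R j - d z y); first lra.
  move=> w yw; exists z; split=> //.
  by have := dist_triangle ax y z w; lra.
have [n ne] := @eps_lt R (e / 2) ltac:(lra).
have [z Sz xz] := dS x _ (eps_gt0 R n).
exists (f z, n); split; first by exists z; rewrite (dist_sym ax z).
move=> y [w [Sw fw wy]]; apply: eO.
have wz : w = z by apply: fI; rewrite ?inE.
by rewrite wz /= in wy; have := dist_triangle ax z x y; lra.
Qed.

(** The identity from the finer space is continuous, so [U] and its complement, both Suslin there,
    remain Suslin in [T]; Suslin's theorem makes [U] Borel. *)
Lemma finer_open_borel (R : realType) (T : topologicalType) (t : Topological T)
    (U : set T) :
  polish R T -> polish R (Topological.Pack t) -> finer t ->
  open (U : set (Topological.Pack t)) -> borel U.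
Proof.
move=> pT pT' fT oU; have cid : continuous (id : Topological.Pack t -> T).
  by apply/continuousP => V oV; exact: fT.
have im (S : set T) : @suslin (Topological.Pack t) S -> suslin S.
  move=> sS; rewrite -(image_id S).
  exact: (suslin_image pT' (polish_hausdorff pT) cid sS).
apply: (bisuslin_borel pT); apply: im; first exact: (suslin_open pT').

by apply: suslin_closed; rewrite closedC.
Qed.

(** Basic rectangles of the finer topologies that miss [D] cover the image of the diagonal. Their
    traces on the Cantor space are Borel, so one of them contains both ends of a pair of [A1], whose
    image is then a point of [A] in a rectangle missing [D]. *)
Lemma separable_irreducible (R : realType) (X Y : topologicalType) (A B : set (X * Y)) :
  polish R X -> polish R Y -> pot_closed_separable R A B ->
  ~ reducible A1 (closure A1 `\` A1) A B.
Proof.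
move=> pX pY [D [[tX [tY [[pX' fX] [pY' fY] cD]]] AD DB0]] [u [v [cu cv uvA uvB]]].
have [U [oU bU]] := polish_base pX'; have [V [oV bV]] := polish_base pY'.
pose C (ij : (nat * nat) * (nat * nat)) : set cantor_space :=
  if pselect ((U ij.1 `*` V ij.2) `&` D = set0) then u @^-1` U ij.1 `&` v @^-1` V ij.2
  else set0.
have [||ij [n [g [C0 C1]]]] := @borel_cover_edge _ C.
- move=> ij; rewrite /C; case: pselect => UVD; last exact: borel0.
  apply: borelI; apply: borel_preimage => //.
    exact: finer_open_borel pX pX' fX (oU _).
  exact: finer_open_borel pY pY' fY (oV _).
- move=> a; have Da : ~ D (u a, v a).
    move=> Da; suff : set0 (u a, v a) by [].
    by rewrite -DB0; split=> //; apply: (uvB (a, a)); rewrite A1_boundary.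
  have : nbhs ((u a, v a) : Topological.Pack tX * Topological.Pack tY) (~` D).
    by apply: open_nbhs_nbhs; split => //; rewrite openC.
  move=> [[P Q] /= [nP nQ] PQD].
  move: nP; rewrite (@nbhsE (Topological.Pack tX)) => -[P' [oP' P'a] P'P].
  move: nQ; rewrite (@nbhsE (Topological.Pack tY)) => -[Q' [oQ' Q'a] Q'Q].
  have [i [Ui UP]] := bU _ _ oP' P'a; have [j [Vj VQ]] := bV _ _ oQ' Q'a.
  exists (i, j); rewrite /C; case: pselect => //= -[]; rewrite -subset0 => -[x y] /= [[Ux Vy]].
  by apply: PQD; split => /=; [exact/P'P/UP|exact/Q'Q/VQ].
move: C0 C1; rewrite /C; case: pselect => // UVD [/= Uu _] [_ /= Vv].
suff : set0 (u (prepend (rcons (sword n) false) g), v (prepend (rcons (sword n) true) g)) by [].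
rewrite -UVD; split => //; apply: AD.
by apply: (uvA (prepend (rcons (sword n) false) g, prepend (rcons (sword n) true) g)); exists n, g.
Qed.

Lemma suslin_imply (T : topologicalType) (P : Prop) (S : set T) :
  (P -> suslin S) -> suslin [set x | P -> S x].
Proof.
have [p /(_ p) sS|np _] := pselect P.
  by rewrite (_ : mkset _ = S) //; apply/seteqP; split=> x //= /(_ p).
rewrite (_ : mkset _ = setT); first exact: suslinT.
by apply/seteqP; split=> x // _ /np.
Qed.

(** * Complements of countable unions of Borel rectangles disjoint from [A] *)

Section LargeSets.
Variables (R : realType) (X Y : topologicalType) (A : set (X * Y)).
Hypotheses (pX : polish R X) (pY : polish R Y) (sA : suslin A).

(** Large sets contain [A], are stable under countable intersections and become closed after a
    refinement: one that misses [B] yields alternative (a). *)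
Definition large (Z : set (X * Y)) : Prop :=
  exists (P : nat -> set X) (Q : nat -> set Y),
    [/\ forall n, borel (P n), forall n, borel (Q n),
        forall n, (P n `*` Q n) `&` A = set0
      & Z = [set z | forall n, ~ (P n `*` Q n) z]].

Lemma large_forall (I : countType) (Z : I -> set (X * Y)) :
  (forall i, large (Z i)) -> large [set z | forall i, Z i z].
Proof.
move=> H; have /choice[PQ PQP] i : exists PQ : nat -> set X * set Y,
    [/\ forall n, borel (PQ n).1, forall n, borel (PQ n).2,
        forall n, ((PQ n).1 `*` (PQ n).2) `&` A = set0
      & Z i = [set z | forall n, ~ ((PQ n).1 `*` (PQ n).2) z]].
  by have [P [Q PQ]] := H i; exists (fun n => (P n, Q n)).
pose F k := if unpickle k is Some (i, n) then PQ i n else (set0, set0).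
exists (fun k => (F k).1), (fun k => (F k).2); split.
- by move=> k; rewrite /F; case: unpickle => [[i n]|]; [case: (PQP i)|exact: borel0].
- by move=> k; rewrite /F; case: unpickle => [[i n]|]; [case: (PQP i)|exact: borel0].
- move=> k; rewrite /F; case: unpickle => [[i n]|]; first by case: (PQP i).
  by rewrite set0X set0I.
- apply/seteqP; split=> z /= Hz.
    move=> k; rewrite /F; case: unpickle => [[i n]|]; last by case.
    by have := Hz i; have [_ _ _ ->] := PQP i; exact.
  move=> i; have [_ _ _ ->] := PQP i => n.
  by have := Hz (pickle (i, n)); rewrite /F pickleK.
Qed.

Lemma large_rectangle (P : set X) (Q : set Y) : borel P -> borel Q ->
  (P `*` Q) `&` A = set0 -> large (~` (P `*` Q)).
Proof.
move=> bP bQ PQA; exists (fun=> P), (fun=> Q); split => //.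
by apply/seteqP; split=> z /= H => [_|]; [exact: H|exact: (H 0%N)].
Qed.

Lemma largeT : large setT.
Proof.
rewrite -setC0 -(set0X (set0 : set Y)); apply: large_rectangle; try exact: borel0.
by rewrite set0X set0I.
Qed.

Lemma largeI Z Z' : large Z -> large Z' -> large (Z `&` Z').
Proof.
move=> lZ lZ'.
rewrite (_ : _ `&` _ = [set z | forall b : bool, (if b then Z else Z') z]).
  by apply: large_forall; case.
by apply/seteqP; split=> z /= => [[Zz Z'z] []//|H]; split; [exact: H true|exact: H false].
Qed.

Lemma large_suslin Z : large Z -> suslin Z.
Proof.
move=> [P [Q [bP bQ _ ->]]].
apply: (@suslin_forall _ _ (fun n => [set z | ~ (P n `*` Q n) z])) => n.
rewrite (_ : mkset _ = (fst @^-1` (~` P n)) `|` (snd @^-1` (~` Q n))).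
  apply: suslinU; apply: suslin_preimage.
  - exact: continuous_fst.
  - exact: (borel_suslin pX (bP n)).2.
  - exact: continuous_snd.
  - exact: (borel_suslin pY (bQ n)).2.
by apply/seteqP; split=> z /= => [/not_andP//|[]nz []].
Qed.

Lemma large_separable (B Z : set (X * Y)) : large Z -> Z `&` B = set0 ->
  pot_closed_separable R A B.
Proof.
move=> [P [Q [bP bQ PQA ->]]] ZB0.
have [tX [pX' fX oP]] := polish_refinement pX bP.
have [tY [pY' fY oQ]] := polish_refinement pY bQ.
exists [set z | forall n, ~ (P n `*` Q n) z]; split => //; last first.
  move=> z Az n PQz; suff : set0 z by [].
  by rewrite -(PQA n).
exists tX, tY; split => //=.
rewrite (_ : mkset _ = ~` \bigcup_n (P n `*` Q n)).
  rewrite closedC; apply: bigcup_open => n _.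
  rewrite openE => z [Pz Qz]; exists (P n, Q n) => //=.
  split; first exact: (@open_nbhs_nbhs (Topological.Pack tX)).
  exact: (@open_nbhs_nbhs (Topological.Pack tY)).
apply/seteqP; split=> z /= H; first by case=> n _ /H.
by move=> n PQz; apply: H; exists n.
Qed.

(** The sides are enlarged one after the other: [P] is separated from the projection of [A] over
    [Q], then [Q] from the projection of [A] over the new side [P'], which is Suslin because it is
    Borel. *)
Lemma enlarge_rectangle (P : set X) (Q : set Y) : suslin P -> suslin Q ->
  (P `*` Q) `&` A = set0 -> exists P' Q', [/\ borel P', borel Q',
    P `<=` P', Q `<=` Q' & (P' `*` Q') `&` A = set0].
Proof.
move=> sP sQ PQA.
have swap_cont (U V : topologicalType) : continuous (fun z : U * V => (z.2, z.1)).
  by apply: continuous_pair; [exact: continuous_snd|exact: continuous_fst].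
have [P' [bP' PP' P'Q]] : borel_separated P
    [set x | exists y, (fst @^-1` Q `&` (fun z => (z.2, z.1)) @^-1` A) (y, x)].
  apply: (suslin_separation pX) => //.
    apply: (suslin_polish_proj pY); apply: suslinI.
      by apply: suslin_preimage sQ; exact: continuous_fst.
    by apply: suslin_preimage sA; exact: swap_cont.
  rewrite -subset0 => x [Px [y [/= Qy Axy]]]; suff : set0 (x, y) by [].
  by rewrite -PQA.
have [Q' [bQ' QQ' Q'P']] : borel_separated Q
    [set y | exists x, (fst @^-1` P' `&` A) (x, y)].
  apply: (suslin_separation pY) => //.
    apply: (suslin_polish_proj pX); apply: suslinI => //.
    by apply: suslin_preimage (borel_suslin pX bP').1; exact: continuous_fst.
  rewrite -subset0 => y [Qy [x [/= P'x Axy]]]; suff : set0 x by [].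
  by rewrite -P'Q; split => //; exists y.
exists P', Q'; split => //; rewrite -subset0 => -[x y] [[/= P'x Q'y] Axy].
suff : set0 y by []; rewrite -Q'P'; split => //; by exists x.
Qed.

End LargeSets.

Lemma hausdorff_pair (T U : topologicalType) :
  hausdorff_space T -> hausdorff_space U -> hausdorff_space (T * U)%type.
Proof.
move=> hT hU [x y] [x' y'] H; congr pair.
  apply: hT => V W xV x'W.
  have [z [/= Vz Wz]] := H _ _ (@continuous_fst T U (x, y) V xV)
    (@continuous_fst T U (x', y') W x'W).
  by exists z.1.
apply: hU => V W yV y'W.
have [z [/= Vz Wz]] := H _ _ (@continuous_snd T U (x, y) V yV)
  (@continuous_snd T U (x', y') W y'W).
by exists z.2.
Qed.

(** * Finite approximations of homomorphisms *)

Section Configurations.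
Variables (R : realType) (X Y : topologicalType).
Variables (fA fB : baire_space -> X * Y).
Hypotheses (pX : polish R X) (pY : polish R Y).
Hypotheses (cA : continuous fA) (cB : continuous fB).

Local Notation A := (range fA).
Local Notation B := (range fB).

(* At stage [n], the index [(None, t)] with [size t = n] stands for a vertex,
   sent to [B] by [fB], and [(Some k, t)] with [size t = n - k.+1] for the edge
   from [sword k ++ false :: t] to [sword k ++ true :: t], sent to [A] by [fA]. *)
Local Notation idx := (option nat * bitseq)%type.

Definition stage (n : nat) : seq idx :=
  [seq (None, t) | t <- words n] ++
  flatten [seq [seq (Some k, t) | t <- words (n - k.+1)] | k <- iota 0 n].

Lemma mem_stage_vertex n t : size t = n -> (None, t) \in stage n.
Proof. by move=> tn; rewrite mem_cat map_f // mem_words tn. Qed.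

Lemma mem_stage_edge n k t : (k < n)%N -> size t = (n - k.+1)%N ->
  (Some k, t) \in stage n.
Proof.
move=> kn tn; rewrite mem_cat; apply/orP; right; apply/flattenP.
exists [seq (Some k, t) | t <- words (n - k.+1)]; last by rewrite map_f // mem_words tn.
by apply/mapP; exists k; rewrite // mem_iota.
Qed.

(** Finitely many digits of finitely many coordinates: approximations range over a countable type,
    so one large set per approximation may be chosen and all of them intersected. *)
Definition code (n : nat) (c : idx -> baire_space) : seq (seq nat) :=
  [seq mkseq (c i) n | i <- stage n].

Lemma codeP n c c' : code n c = code n c' <->
  forall i, i \in stage n -> forall j, (j < n)%N -> c i j = c' i j.
Proof.
rewrite -eq_in_map; split=> H i /H.
  by move=> e j jn; rewrite -(nth_mkseq 0%N (c i) jn) e nth_mkseq.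
move=> e; apply: (@eq_from_nth _ 0%N); rewrite !size_mkseq // => j jn.
by rewrite !nth_mkseq // e.
Qed.

Definition valid (n : nat) (c : idx -> baire_space) : Prop :=
  forall k t, (k < n)%N -> size t = (n - k.+1)%N ->
    fA (c (Some k, t)) = ((fB (c (None, sword k ++ false :: t))).1,
                          (fB (c (None, sword k ++ true :: t))).2).

Definition config (n : nat) (p : seq (seq nat)) (Z : set (X * Y))
    (c : idx -> baire_space) : Prop :=
  [/\ code n c = p, valid n c & forall t, size t = n -> Z (fB (c (None, t)))].

(** Stage [n.+1] consists of two copies of stage [n], given by [c] and [c'], and of one new edge
    between their copies of [sword n]; here no such edge can be filled in. *)
Definition terminal (n : nat) (p : seq (seq nat)) (Z : set (X * Y)) : Prop :=
  forall c c', config n p Z c -> config n p Z c' ->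
    ~ A ((fB (c (None, sword n))).1, (fB (c' (None, sword n))).2).

Lemma config_sub n p (Z Z' : set (X * Y)) c : Z `<=` Z' -> config n p Z c -> config n p Z' c.
Proof. by move=> ZZ' [cp vc Zc]; split=> // t /Zc /ZZ'. Qed.

Lemma terminal_sub n p (Z Z' : set (X * Y)) : Z `<=` Z' -> terminal n p Z' -> terminal n p Z.
Proof.
by move=> ZZ' T c c' /(config_sub ZZ') Hc /(config_sub ZZ'); exact: T.
Qed.

Let dec (w : baire_space) (i : idx) : baire_space := strand i w.

Let continuous_dec i : continuous (dec^~ i).
Proof. exact: strand_continuous. Qed.

Lemma config_suslin n p Z : suslin Z ->
  suslin [set w : baire_space | config n p Z (dec w)].
Proof.
move=> sZ; have hXY := hausdorff_pair (polish_hausdorff pX) (polish_hausdorff pY).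
rewrite (_ : mkset _ = [set w : baire_space | code n (dec w) = p] `&`
  ([set w | forall kt : nat * bitseq, (kt.1 < n)%N /\ size kt.2 = (n - kt.1.+1)%N ->
     fA (dec w (Some kt.1, kt.2)) = ((fB (dec w (None, sword kt.1 ++ false :: kt.2))).1,
       (fB (dec w (None, sword kt.1 ++ true :: kt.2))).2)] `&`
   [set w | forall t : bitseq, size t = n -> Z (fB (dec w (None, t)))])); last first.
  apply/seteqP; split=> w [/=].
    by move=> cp vw Zw; split=> //; split=> // -[k t] /= [kn tn]; exact: vw.
  by move=> cp [vw Zw]; split=> // k t kn tn; exact: (vw (k, t)).
apply: suslinI; last apply: suslinI.
- have [[w0 w0p]|np] := pselect (exists w0, code n (dec w0) = p); last first.
    rewrite (_ : mkset _ = set0); first exact: suslin0.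
    by rewrite -subset0 => w wp; apply: np; exists w.
  rewrite (_ : mkset _ = [set w : baire_space | forall ij : idx * nat,
      ij.1 \in stage n /\ (ij.2 < n)%N -> dec w ij.1 ij.2 = dec w0 ij.1 ij.2]).
    apply: suslin_forall => -[i j]; apply: suslin_imply => _ /=.
    apply: suslin_closed; apply: (@closed_equalizer _ nat) => //; last exact: cst_continuous.
      exact: discrete_hausdorff.
    exact: (@proj_continuous _ (fun _ => nat)).
  apply/seteqP; split=> w /=.
    by rewrite -w0p => /codeP H [i j] [/= /H]; exact.
  by move=> H; rewrite -w0p; apply/codeP => i iS j jn; exact: (H (i, j)).
- apply: suslin_forall => -[k t]; apply: suslin_imply => _ /=.
  apply: suslin_closed; apply: closed_equalizer => //.
    exact: continuous_compose (@continuous_dec _) cA.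
  apply: continuous_pair.
    apply: continuous_compose (@continuous_fst _ _).
    exact: continuous_compose (@continuous_dec _) cB.
  apply: continuous_compose (@continuous_snd _ _).
  exact: continuous_compose (@continuous_dec _) cB.
- apply: suslin_forall => t; apply: suslin_imply => _.
  apply: (@suslin_preimage _ _ (fun w => fB (dec w (None, t)))) sZ.
  exact: continuous_compose (@continuous_dec _) cB.
Qed.

Let sA : suslin A.
Proof.
rewrite (_ : A = [set z | exists w : baire_space, [set q | fA q.1 = q.2] (w, z)]).
  apply: suslin_baire_proj; apply: suslin_closed; apply: closed_equalizer.
  - exact: hausdorff_pair (polish_hausdorff pX) (polish_hausdorff pY).
  - exact: continuous_compose (@continuous_fst _ _) cA.
  - exact: continuous_snd.
by apply/seteqP; split=> z [w]; [exists w|exists w].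
Qed.

Let large := large A.

(** Since [terminal] lets [c] and [c'] vary independently, the whole rectangle spanned by the first
    and the second coordinates of the values at [sword n] misses [A]. *)
Lemma terminal_separated n p Z : large Z -> terminal n p Z ->
  exists2 Z', large Z' & forall c, config n p Z c -> ~ Z' (fB (c (None, sword n))).
Proof.
move=> lZ tZ.
have sC : suslin [set w | config n p Z (dec w)].
  exact/config_suslin/(large_suslin pX pY lZ).
have cv : continuous (fun w => fB (dec w (None, sword n))).
  exact: continuous_compose (@continuous_dec _) cB.
have dec_surj c : exists w, dec w = c.
  by exists (braid c); apply/funext => i; exact: strand_braid.
have [|||P [Q [bP bQ PP QQ PQA]]] := @enlarge_rectangle R X Y A pX pY sA
    ((fun w => (fB (dec w (None, sword n))).1) @` [set w | config n p Z (dec w)])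
    ((fun w => (fB (dec w (None, sword n))).2) @` [set w | config n p Z (dec w)]).
- apply: (suslin_image (polish_baire R) (polish_hausdorff pX)) => //.
  exact: continuous_compose cv (@continuous_fst _ _).
- apply: (suslin_image (polish_baire R) (polish_hausdorff pY)) => //.
  exact: continuous_compose cv (@continuous_snd _ _).
- rewrite -subset0 => -[x y] [[/= [w Cw <-] [w' Cw' <-]]].
  exact: tZ.
exists (~` (P `*` Q)); first exact: large_rectangle.
move=> c Cc; apply; have [w wc] := dec_surj c; rewrite -wc in Cc *.
by split; [apply: PP|apply: QQ]; exists w.
Qed.

(** The last bit of the word selects the copy. At stage [n.+1] the empty word occurs only in the
    index [(Some n, [::])] of the new edge, which receives [e]. *)
Definition join (c0 c1 : idx -> baire_space) (e : baire_space) : idx -> baire_space :=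
  fun i => if i.2 is b :: t then (if last b t then c1 else c0) (i.1, belast b t) else e.

Lemma join_rcons c0 c1 e o t b :
  join c0 c1 e (o, rcons t b) = (if b then c1 else c0) (o, t).
Proof. by case: t => [|x t] //=; rewrite /join /= last_rcons belast_rcons. Qed.

Lemma config_join n p Z c0 c1 e : config n p Z c0 -> config n p Z c1 ->
  fA e = ((fB (c0 (None, sword n))).1, (fB (c1 (None, sword n))).2) ->
  config n.+1 (code n.+1 (join c0 c1 e)) Z (join c0 c1 e).
Proof.
move=> [_ v0 Z0] [_ v1 Z1] fe; split=> //.
- move=> k t; rewrite ltnS subSS leq_eqVlt => /predU1P[->|kn].
    rewrite subnn => /size0nil ->.
    by rewrite !cats1 !join_rcons.
  case: (lastP t) => [/= /eqP|{}t b]; first by rewrite eq_sym subn_eq0 leqNgt kn.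
  rewrite size_rcons -(subnSK kn) => -[tn].
  by rewrite -!rcons_cons -!rcons_cat !join_rcons; case: b; [exact: v1|exact: v0].
- move=> t; case: (lastP t) => [//|{}t b]; rewrite size_rcons => -[tn].
  by rewrite join_rcons; case: b; [exact: Z1|exact: Z0].
Qed.

(* Every approximation that is terminal for some large set is terminal for [Z2], and
   [Z4] removes from [Z2] the rectangles spoiled by terminal approximations, so that
   any configuration in [Z4] has a non-terminal approximation. *)
Lemma large_or_fusion : (exists2 Z, large Z & Z `&` B = set0) \/
  exists c : nat -> idx -> baire_space, forall n, valid n (c n) /\
    forall o t b j, (o, t) \in stage n -> (j < n)%N ->
      c n.+1 (o, rcons t b) j = c n (o, t) j.
Proof.
have /choice[Z1 Z1P] (np : nat * seq (seq nat)) : exists Z, large Z /\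
    ((exists2 Z', large Z' & terminal np.1 np.2 Z') -> terminal np.1 np.2 Z).
  have [[Z lZ tZ]|H] := pselect (exists2 Z', large Z' & terminal np.1 np.2 Z').
    by exists Z.
  by exists setT; split=> [|/H//]; exact: largeT.
pose Z2 := [set z | forall np, Z1 np z].
have lZ2 : large Z2 by apply: large_forall => np; exact: (Z1P np).1.
have Z2_terminal n p Z : large Z -> terminal n p Z -> terminal n p Z2.
  move=> lZ tZ; apply: terminal_sub ((Z1P (n, p)).2 _); last by exists Z.
  by move=> z; exact.
have /choice[Z3 Z3P] (np : nat * seq (seq nat)) : exists Z, large Z /\
    (terminal np.1 np.2 Z2 -> forall c, config np.1 np.2 Z2 c ->
       ~ Z (fB (c (None, sword np.1)))).
  have [/(terminal_separated lZ2)[Z lZ HZ]|nt] := pselect (terminal np.1 np.2 Z2).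
    by exists Z.
  by exists setT; split=> [|/nt//]; exact: largeT.
pose Z4 := Z2 `&` [set z | forall np, Z3 np z].
have lZ4 : large Z4.
  by apply: largeI => //; apply: large_forall => np; exact: (Z3P np).1.
have Z42 : Z4 `<=` Z2 by move=> z [].
have Z4_nonterminal n p c : config n p Z4 c -> ~ terminal n p Z2.
  move=> Cc /(Z3P (n, p)).2 /(_ c (config_sub Z42 Cc)); apply.
  have [_ _ /(_ (sword n) (size_sword n))[_]] := Cc; exact.
have [Z4B|] := pselect (Z4 `&` B = set0); first by left; exists Z4.
move=> /eqP/set0P[z [Z4w [w _ wz]]]; right; rewrite -{z}wz in Z4w.
pose good n c := ~ terminal n (code n c) Z2 /\ valid n c.
have good0 : good 0%N (fun=> w).
  split=> //; apply: (@Z4_nonterminal _ _ (fun=> w)); split=> //.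
have good_step n c : exists c', good n c -> good n.+1 c' /\
    forall o t b j, (o, t) \in stage n -> (j < n)%N ->
      c' (o, rcons t b) j = c (o, t) j.
  have [[nt _]|ng] := pselect (good n c); last by exists c.
  (* [Z4] is large, so terminality for [Z4] would give terminality for [Z2]. Hence an edge joins two
     configurations in [Z4] with the same code as [c]; their join lies in [Z4] again, so its
     approximation is not terminal. *)
  have : ~ terminal n (code n c) Z4 by move=> /(Z2_terminal _ _ _ lZ4).
  move=> /existsNP[c0 /existsNP[c1 /not_implyP[C0 /not_implyP[C1 /contrapT[e _ fe]]]]].
  exists (join c0 c1 e) => _; have Cj := config_join C0 C1 fe; split.
    by split; [exact: Z4_nonterminal Cj|case: Cj].
  move=> o t b j ts jn; rewrite join_rcons.
  have [/codeP e0 _ _] := C0; have [/codeP e1 _ _] := C1.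
  by case: b; [exact: e1|exact: e0].
have /choice[g gP] (nc : nat * (idx -> baire_space)) := good_step nc.1 nc.2.
pose c := fix c n := if n is m.+1 then g (m, c m) else fun=> w.
have gc n : good n (c n) by elim: n => [//|n /(gP (n, c n))[]].
by exists c => n; split; [case: (gc n)|have [] := gP (n, c n) (gc n)].
Qed.

(** * The limit homomorphism *)

Section Fusion.
Variable c : nat -> idx -> baire_space.
Hypothesis valid_c : forall n, valid n (c n).
Hypothesis coherent : forall n o t b j, (o, t) \in stage n -> (j < n)%N ->
  c n.+1 (o, rcons t b) j = c n (o, t) j.

(** Digit [j] is read at a stage beyond [j], after which [coherent] freezes it. For an edge of level
    [k], stage [j + k.+1] is the one whose words [t] have length [j]. *)
Let vertex (a : cantor_space) : baire_space := fun j => c j.+1 (None, mkseq a j.+1) j.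

Let edge (k : nat) (g : cantor_space) : baire_space :=
  fun j => c (j + k.+1)%N (Some k, mkseq g j) j.

Let mkseq_rcons (a : nat -> bool) n : mkseq a n.+1 = rcons (mkseq a n) (a n).
Proof. by rewrite /mkseq -addn1 iotaD map_cat cats1. Qed.

Let vertex_agree a n : agree n (vertex a) (c n (None, mkseq a n)).
Proof.
elim: n => [//|n IH] j; rewrite ltnS leq_eqVlt => /predU1P[->//|jn].
rewrite mkseq_rcons coherent // ?mem_stage_vertex ?size_mkseq //.
exact: IH.
Qed.

Let edge_agree k g n : agree n (edge k g) (c (n + k.+1)%N (Some k, mkseq g n)).
Proof.
elim: n => [//|n IH] j; rewrite ltnS => jn.
rewrite addSn mkseq_rcons coherent; last by rewrite addnS ltnS (leq_trans jn) ?leq_addr.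
  by move: jn; rewrite leq_eqVlt => /predU1P[->//|]; exact: IH.
by apply: mem_stage_edge; rewrite ?size_mkseq ?addnK // addnS ltnS leq_addl.
Qed.

Let mkseq_prepend k b (g : cantor_space) n :
  mkseq (prepend (rcons (sword k) b) g) (n + k.+1) = sword k ++ b :: mkseq g n.
Proof.
rewrite -cat_rcons; have sk : size (rcons (sword k) b) = k.+1.
  by rewrite size_rcons size_sword.
apply: (@eq_from_nth _ false); first by rewrite size_cat !size_mkseq sk addnC.
rewrite size_mkseq => i ink; rewrite nth_mkseq // nth_cat /prepend.
case: ifP => // /negbT; rewrite -leqNgt sk => ki.
by rewrite nth_mkseq // -(ltn_add2r k.+1) subnK.
Qed.

(** The edge relation [F] between codes is closed, by continuity of [fA] and [fB], and [valid]
    supplies points of it arbitrarily close to the limit codes. *)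
Let fusion_edge k g : fA (edge k g) =
  ((fB (vertex (prepend (rcons (sword k) false) g))).1,
   (fB (vertex (prepend (rcons (sword k) true) g))).2).
Proof.
pose F : set (baire_space * (baire_space * baire_space)) :=
  [set q | fA q.1 = ((fB q.2.1).1, (fB q.2.2).2)].
have cF : closed F.
  apply: closed_equalizer.
  - exact: hausdorff_pair (polish_hausdorff pX) (polish_hausdorff pY).
  - exact: continuous_compose (@continuous_fst _ _) cA.
  apply: continuous_pair.
    apply: continuous_compose (@continuous_fst _ _).
    apply: continuous_compose cB.
    exact: continuous_compose (@continuous_snd _ _) (@continuous_fst _ _).
  apply: continuous_compose (@continuous_snd _ _).
  apply: continuous_compose cB.
  exact: continuous_compose (@continuous_snd _ _) (@continuous_snd _ _).
suff : F (edge k g, (vertex (prepend (rcons (sword k) false) g),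
                     vertex (prepend (rcons (sword k) true) g))) by [].
apply: cF => W [[U V] /= [/(@nbhs_seqP nat)[n nU]]].
move=> [[V0 V1] /= [/(@nbhs_seqP nat)[n0 nV0] /(@nbhs_seqP nat)[n1 nV1]] VV UVW].
pose m := maxn n (maxn n0 n1).
have nm : (n <= m)%N by rewrite leq_maxl.
have n0m : (n0 <= m + k.+1)%N.
  by rewrite (leq_trans _ (leq_addr _ _)) // (leq_trans (leq_maxl n0 n1)) // leq_maxr.
have n1m : (n1 <= m + k.+1)%N.
  by rewrite (leq_trans _ (leq_addr _ _)) // (leq_trans (leq_maxr n0 n1)) // leq_maxr.
exists (c (m + k.+1)%N (Some k, mkseq g m),
  (c (m + k.+1)%N (None, mkseq (prepend (rcons (sword k) false) g) (m + k.+1)),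
   c (m + k.+1)%N (None, mkseq (prepend (rcons (sword k) true) g) (m + k.+1)))).
split.
  rewrite /F /= !mkseq_prepend; apply: valid_c; first by rewrite addnS ltnS leq_addl.
  by rewrite size_mkseq addnK.
apply: UVW; split; first by apply: nU; exact: agree_le nm (@edge_agree _ _ _).
apply: VV; split; first by apply: nV0; exact: agree_le n0m (@vertex_agree _ _).
by apply: nV1; exact: agree_le n1m (@vertex_agree _ _).
Qed.

Lemma fusion_reducible : reducible A1 (closure A1 `\` A1) A B.
Proof.
have cv : continuous vertex.
  apply/(@continuous_to_seqP nat) => j; apply/(@continuous_seqP bool) => a U _ Ua.
  exists j.+1 => b ab; rewrite /vertex (_ : mkseq b j.+1 = mkseq a j.+1) //.
  by apply/eq_in_map => i; rewrite mem_iota => /andP[_ /ab].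
exists (fun a => (fB (vertex a)).1), (fun a => (fB (vertex a)).2); split.
- by apply: continuous_compose (@continuous_fst _ _); exact: continuous_compose cv cB.
- by apply: continuous_compose (@continuous_snd _ _); exact: continuous_compose cv cB.
- by move=> _ [n [g ->]]; exists (edge n g) => //; exact: fusion_edge.
- rewrite A1_boundary => -[a _] /= <-; exists (vertex a) => //.
  by rewrite -surjective_pairing.
Qed.

End Fusion.

End Configurations.

Lemma analytic_param (R : realType) (T : topologicalType) (A : set T) :
  analytic R A -> A = set0 \/ exists2 f : baire_space -> T, continuous f & A = range f.
Proof.
move=> [P [pP [f [cf fA]]]].
have [[x0 _]|noP] := pselect (exists x : P, True); [right|left]; last first.
  by rewrite -fA -subset0 => y [x _ _]; apply: noP; exists x.
have [g [cg gP]] := polish_baire_image x0 pP.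
exists (f \o g); first exact: continuous_compose cg cf.
rewrite -fA; apply/seteqP; split=> _ [x _ <-]; last by exists (g x).
by have [a <-] := gP x; exists a.
Qed.

Lemma reducible_dichotomy (R : realType) : dichotomy R (reducible A1 (closure A1 `\` A1)).
Proof.
move=> X Y pX pY A B aA aB _; split; last first.
  by move=> [/(separable_irreducible pX pY)].
have [A0|[fA cA AE]] := analytic_param aA.
  left; apply: (@large_separable _ _ _ _ pX pY B (~` (setT `*` setT))).
    by apply: large_rectangle; [exact/borel_open/openT..|rewrite A0 setI0].
  by rewrite -subset0 => z [[]].
have [B0|[fB cB BE]] := analytic_param aB.
  by left; apply: (large_separable pX pY (largeT A)); rewrite B0 setI0.
rewrite AE BE; have [[Z lZ ZB]|[c cP]] := large_or_fusion pX pY cA cB.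
  by left; exact: large_separable lZ ZB.
right; apply: (fusion_reducible pX pY cA cB (c := c)) => [n|n o t b j].
  by case: (cP n).
by have [_] := cP n; exact.
Qed.

(** * Counterexamples *)

Section Counterexamples.
Variable R : realType.

(** Entry 0 is skipped and stays free to name the index [n] of a pair of [A1]. *)
Let bits (w : baire_space) : cantor_space := fun k => w k.+1 != 0%N.

Let bits_continuous : continuous bits.
Proof.
apply/(@continuous_to_seqP bool) => j; apply/(@continuous_seqP nat) => a U _ Ua.
by exists j.+2 => b ab; rewrite /bits ab.
Qed.

Let bits_surj a n : exists2 w, bits w = a & w 0%N = n.
Proof.
exists (fun k => if k is j.+1 then nat_of_bool (a j) else n) => //.
by apply/funext => k; rewrite /bits; case: (a k).
Qed.

Lemma analytic_range (T : topologicalType) (f : baire_space -> T) :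
  continuous f -> analytic R (range f).
Proof. by move=> cf; exists baire_space; split; [exact: polish_baire|exists f]. Qed.

Lemma analytic_image (T U : topologicalType) (f : T -> U) (A : set T) :
  continuous f -> analytic R A -> analytic R (f @` A).
Proof.
move=> cf [P [pP [g [cg <-]]]]; exists P; split=> //; exists (f \o g).
by split; [exact: continuous_compose cg cf|rewrite image_comp].
Qed.

Lemma analytic_A1 : analytic R A1.
Proof.
pose f b (w : baire_space) := prepend (rcons (sword (w 0%N)) b) (bits w).
rewrite (_ : A1 = range (fun w => (f false w, f true w))).
  have cf b : continuous (f b).
    apply/(@continuous_to_seqP bool) => j; apply/(@continuous_seqP nat) => a U _ Ua.
    exists j.+2 => c ac; have c0 : c 0%N = a 0%N by exact: ac.
    move: Ua; rewrite /f /prepend c0; case: ifP => // jS.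
    by rewrite /bits ac // !ltnS leq_subr.
  by apply: analytic_range; apply: continuous_pair.
apply/seteqP; split=> [_ [n [g ->]]|_ [w _ <-]]; last by exists (w 0%N), (bits w).
by have [w wg wn] := bits_surj g n; exists w => //; rewrite /f wg wn.
Qed.

Lemma analytic_diagonal : analytic R [set p : cantor_space * cantor_space | p.1 = p.2].
Proof.
rewrite (_ : mkset _ = range (fun w => (bits w, bits w))).
  by apply: analytic_range; apply: continuous_pair; exact: bits_continuous.
apply/seteqP; split=> [[a _] /= <-|_ [w _ <-]//].
by have [w wa _] := bits_surj a 0%N; exists w; rewrite ?wa.
Qed.

Lemma not_dichotomy_complement : ~ dichotomy R (reducible A1 (~` A1)).
Proof.
move=> H; have pC := polish_cantor R.
have A1D0 : A1 `&` [set p | p.1 = p.2] = set0.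
  by rewrite -A1_boundary -subset0 => p [? []].
have [[sep|[u [v [_ _ uvA uvB]]]] _] := H _ _ pC pC _ _ analytic_A1 analytic_diagonal A1D0.
  apply: (separable_irreducible pC pC sep); exists id, id.
  split; try by move=> x; exact: cvg_id.
    by move=> [].
  by rewrite A1_boundary => -[].
have A1xx a : ~ A1 (a, a) by move=> /A1P[n [_ -> ]].
(* The pairs [(a, a)], [(b, b)] and [(b, a)] lie outside [A1], so they go to the diagonal and all
   the values of [u] and [v] at [a] and [b] coincide; yet [(a, b)] has to go to [A1]. *)
pose a : cantor_space := fun=> false; pose b : cantor_space := fun k => k == 0%N.
have ab : A1 (a, b) by apply/A1P; exists 0%N; split => // k /negbTE; exact.
have ba : ~ A1 (b, a).
  by move=> /A1P[n [_ _ ]].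
have /= e1 := uvB (a, a) (A1xx a); have /= e2 := uvB (b, b) (A1xx b).
have /= e3 := uvB (b, a) ba.
by apply: (A1xx (u a)); have := uvA _ ab; rewrite /= -e2 e3 -e1.
Qed.

Fixpoint lex_lt (s t : bitseq) : bool :=
  match s, t with
  | x :: s', y :: t' => (~~ x && y) || ((x == y) && lex_lt s' t')
  | _, _ => false
  end.

Lemma lex_ltxx s : lex_lt s s = false.
Proof. by elim: s => //= x s ->; case: x. Qed.

Lemma lex_lt_trans s t r : lex_lt s t -> lex_lt t r -> lex_lt s r.
Proof.
elim: s t r => [|x s IH] [|y t] [|z r] //=.
by case: x; case: y; case: z => //=; exact: IH.
Qed.

Lemma lex_lt_rcons s t x y : size s = size t -> lex_lt s t -> lex_lt (rcons s x) (rcons t y).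
Proof.
elim: s t => [|a s IH] [|b t] //= [st] /orP[->//|/andP[-> /(IH _ st) ->]].
by rewrite orbT.
Qed.

Lemma lex_lt_rcons_last s : lex_lt (rcons s false) (rcons s true).
Proof. by elim: s => //= x s ->; rewrite eqxx orbT. Qed.

(* The bit [a m] is erased when the word read so far exceeds that of [sword m]. This
   keeps the two ends of each pair of [A1] apart, but if [a] starts with [sword m] and
   [n < m] is such that [(a, raise n a)] is in [A1], then the bit [m] of [raise n a] is
   erased. [shadow n a] is the initial segment of length [n] of [collapse a]. *)
Fixpoint shadow (n : nat) (a : nat -> bool) : bitseq :=
  if n is m.+1 then
    rcons (shadow m a) (a m && ~~ lex_lt (shadow m (nth false (sword m))) (shadow m a))
  else [::].

Definition collapse (a : cantor_space) : cantor_space :=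
  fun m => a m && ~~ lex_lt (shadow m (nth false (sword m))) (shadow m a).

Definition raise (n : nat) (a : cantor_space) : cantor_space :=
  fun k => if k == n then true else a k.

Lemma size_shadow n a : size (shadow n a) = n.
Proof. by elim: n => //= n IH; rewrite size_rcons IH. Qed.

Lemma shadow_agree n a b : agree n a b -> shadow n b = shadow n a.
Proof.
elim: n => //= n IH ab; rewrite IH ?(ab n) //.
exact: agree_le ab.
Qed.

Lemma shadowE n a : shadow n a = mkseq (collapse a) n.
Proof.
elim: n => // n IH; have -> : shadow n.+1 a = rcons (shadow n a) (collapse a n) by [].
by rewrite IH /mkseq -addn1 iotaD map_cat cats1.
Qed.

Lemma A1_raise a b : A1 (a, b) <->
  exists n, [/\ cyl (sword n) a, a n = false & b = raise n a].
Proof.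
rewrite A1P; split=> -[n [sa an]].
  move=> bn ba; exists n; split=> //; apply/funext => k; rewrite /raise.
  by case: eqVneq => [->//|/ba].
by move=> ->; exists n; split=> //; rewrite /raise ?eqxx // => k /negbTE ->.
Qed.

Lemma shadow_sword n a : cyl (sword n) a -> shadow n (nth false (sword n)) = shadow n a.
Proof. by move/cylP=> sa; apply: shadow_agree => i lein; rewrite sa // size_sword. Qed.

Lemma raise_agree n a : agree n a (raise n a).
Proof. by move=> k kn; rewrite /raise ltn_eqF. Qed.

Lemma collapse_raise n a : cyl (sword n) a -> a n = false ->
  [/\ agree n (collapse a) (collapse (raise n a)), collapse a n = false
    & collapse (raise n a) n = true].
Proof.
move=> sa an; split.
- move=> k kn; have E := shadow_agree (agree_le (ltnW kn) (@raise_agree n a)).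
  by rewrite /collapse E (raise_agree _ kn).
- by rewrite /collapse an.
- rewrite /collapse (shadow_agree (@raise_agree n a)) (shadow_sword sa) lex_ltxx.
  by rewrite /raise eqxx.
Qed.

Lemma shadow_raise_lt n m a : cyl (sword n) a -> a n = false -> (n < m)%N ->
  lex_lt (shadow m a) (shadow m (raise n a)).
Proof.
move=> sa an /subnKC <-; elim: (m - n.+1)%N => [|k IH].
  have [_ c0 c1] := collapse_raise sa an.
  rewrite addn0 /= -/(collapse a n) -/(collapse (raise n a) n) c0 c1.
  by rewrite (shadow_agree (@raise_agree n a)) lex_lt_rcons_last.
have sz : size (shadow (n.+1 + k) a) = size (shadow (n.+1 + k) (raise n a)).
  by rewrite !size_shadow.
by rewrite addnS; exact: lex_lt_rcons sz IH.
Qed.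

(** Erasure at [m] depends only on the shadow up to [m], so the bits need to agree only where they
    survive, and equality of shadows propagates by induction. *)
Lemma collapse_eq a b : (forall m, shadow m a = shadow m b ->
  lex_lt (shadow m (nth false (sword m))) (shadow m a) \/ a m = b m) ->
  collapse a = collapse b.
Proof.
move=> H; have E m : shadow m a = shadow m b.
  elim: m => //= m IH; rewrite -IH; congr rcons.
  by have [->|->] := H m IH; rewrite ?andbF.
by apply/funext => m; rewrite /collapse -E; have [->|->] := H m (E m); rewrite ?andbF.
Qed.

(** Bits below [n] come from [sword n]. Beyond [n], raising increases the shadow lexicographically,
    so a bit that survives in [raise n a] survives in [a] too, where equality of the collapses reads
    it. *)
Lemma collapse_raise_eq n a b : cyl (sword n) a -> a n = false ->
  cyl (sword n) b -> b n = false -> collapse a = collapse b ->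
  collapse (raise n a) = collapse (raise n b).
Proof.
move=> sa an sb bn cab; apply: collapse_eq => m _.
have sab k : shadow k a = shadow k b by rewrite !shadowE cab.
have [mn|nm|<-] := ssrnat.ltngtP m n.
- by right; rewrite !raise_agree // ((cylP _ _).1 sa) ?((cylP _ _).1 sb) ?size_sword.
- case L : (lex_lt _ _); [by left|right]; rewrite /raise gtn_eqF //.
  have := congr1 (@^~ m) cab; rewrite /collapse -sab.
  suff -> : lex_lt (shadow m (nth false (sword m))) (shadow m a) = false by rewrite !andbT.
  apply/negbTE/negP => /lex_lt_trans/(_ (shadow_raise_lt sa an nm)).
  by rewrite L.
- by right; rewrite /raise eqxx.
Qed.

Lemma collapse_raise_raise n m a : cyl (sword n) a -> a n = false -> (n < m)%N ->
  cyl (sword m) a -> collapse (raise n a) = collapse (raise n (raise m a)).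
Proof.
move=> sa an nm sma; apply: collapse_eq => k _.
have [->|km] := eqVneq k m; last by right; rewrite /raise (negbTE km).
by left; rewrite (shadow_sword sma); exact: shadow_raise_lt.
Qed.

Lemma collapse_continuous : continuous collapse.
Proof.
apply/(@continuous_to_seqP bool) => j; apply/(@continuous_seqP bool) => a U _ Ua.
exists j.+1 => b ab; have E := shadow_agree (agree_le (leqnSn j) ab).
by rewrite /collapse E (ab j).
Qed.

Let graph_map (p : cantor_space * cantor_space) := (p.1, collapse p.2).

Let graph_map_continuous : continuous graph_map.
Proof.
apply: continuous_pair; first exact: continuous_fst.
exact: continuous_compose (@continuous_snd _ _) collapse_continuous.
Qed.

Let GA := graph_map @` A1.
Let GB := graph_map @` [set p | p.1 = p.2].

(** On [GB] the second coordinate is the collapse of the first, so [v] is [collapse] after [u], and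
    each pair of [A1] is sent to a raising of one bit. Near [a0], pairs differing at bit 0 are all
    sent to raisings of the same bit [n], while a pair differing at a far bit [j] is sent to a
    raising of some bit [m > n]. As [collapse] erases bit [m] once bit [n] is raised, [v] identifies
    [raise 0 a] with [raise 0 (raise j a)]. *)
Let not_inj_reducible : ~ inj_reducible A1 (closure A1 `\` A1) GA GB.
Proof.
move=> [u [v [_ [/(@continuous_seqP bool) cv vi] uvA uvB]]].
have vE a : v a = collapse (u a).
  have : GB (u a, v a) by apply: (uvB (a, a)); rewrite A1_boundary.
  by move=> [[x _] /= <- [<- <-]].
have edge a b : A1 (a, b) -> exists n, [/\ cyl (sword n) (u a), u a n = false,
    v b = collapse (raise n (u a)), agree n (v a) (v b) & v a n = false /\ v b n = true].
  move=> ab; have [[x y] /A1_raise[n [sx xn yx]] /= [xu yv]] := uvA _ ab.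
  rewrite {x}xu in sx xn yx; rewrite -yv yx vE; exists n.
  by have [] := collapse_raise sx xn.
have edge_raise n a : cyl (sword n) a -> a n = false -> A1 (a, raise n a).
  by move=> sa an; apply/A1_raise; exists n.
have s0 a : cyl (sword 0) a by apply/cylP => i; rewrite size_sword.
pose a0 : cantor_space := fun=> false.
have [n [_ _ _ ag0 [va0 vb0]]] := edge _ _ (edge_raise 0%N a0 (s0 _) erefl).
have near (x : cantor_space) : exists N, forall y, agree N x y -> agree n.+1 (v x) (v y).
  apply: (cv x [set z | agree n.+1 (v x) z]) => //.
  by apply/(@open_seqP bool) => z xz; exists n.+1 => y zy; exact: agree_trans xz zy.
have [Na NaP] := near a0; have [Nb NbP] := near (raise 0 a0).
(* The successor makes [N] positive, whence [j != 0] and bit 0 of [a] and of [a'] is [false]. *)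
pose N := (maxn Na Nb).+1.
(* The first difference of [v a] and [v b] determines [n] and is locally constant. *)
have label a b : agree N a0 a -> A1 (a, b) -> b = raise 0 a ->
    [/\ cyl (sword n) (u a), u a n = false & v b = collapse (raise n (u a))].
  move=> a0a /edge[k [su uk vb abk [vak vbk]]] ba.
  have va : agree n.+1 (v a0) (v a).
    by apply: NaP; apply: agree_le a0a; rewrite /N leqW // leq_maxl.
  have vb' : agree n.+1 (v (raise 0 a0)) (v b).
    apply: NbP; rewrite ba => i iN; rewrite /raise; case: eqP => // _.
    by apply: a0a; rewrite /N ltnS ltnW // (leq_trans iN) // leq_maxr.
  suff kn : k = n by rewrite -kn.
  have [kn|nk|//] := ssrnat.ltngtP k n.
    by have := ag0 k kn; rewrite -(va k (ltnW kn)) -(vb' k (ltnW kn)) vak vbk.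
  by have := abk n nk; rewrite (va n (leqnn _)) (vb' n (leqnn _)) va0 vb0.
have [j [t jt]] := sword_dense (mkseq a0 N).
have Nj : (N <= j)%N by rewrite -(size_sword j) jt size_cat size_mkseq leq_addr.
have j0 : j != 0%N by apply: contraTneq Nj => ->.
pose a : cantor_space := nth false (sword j).
have sja : cyl (sword j) a by apply/cylP.
have aj : a j = false by rewrite /a nth_default // size_sword.
pose a' := raise j a.
have a0a : agree N a0 a.
  by move=> i iN; rewrite /a jt nth_cat size_mkseq iN nth_mkseq.
have a0a' : agree N a0 a' := agree_trans a0a (agree_le Nj (@raise_agree j a)).
have a00 : a 0%N = false by rewrite a0a.
have a'00 : a' 0%N = false by rewrite a0a'.
have [su un vb] := label _ _ a0a (edge_raise 0%N a (s0 _) a00) erefl.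
have [su' un' vb'] := label _ _ a0a' (edge_raise 0%N a' (s0 _) a'00) erefl.
have [m [sm um vm am [vam va'm]]] := edge _ _ (edge_raise j a sja aj).
(* Both [v a] and [v a'] agree with [v a0] up to bit [n], whereas they differ at bit [m]. *)
have nm : (n < m)%N.
  rewrite ltnNge; apply/negP => mn.
  have va : agree n.+1 (v a0) (v a) by apply: NaP; apply: agree_le a0a; rewrite /N leqW // leq_maxl.
  have va' : agree n.+1 (v a0) (v a').
    by apply: NaP; apply: agree_le a0a'; rewrite /N leqW // leq_maxl.
  by have := va m mn; rewrite -(va' m mn) vam va'm.
have : raise 0 a = raise 0 a'.
  (* [u a'] is known only up to [collapse], as having the same image as [raise m (u a)];
     [collapse_raise_eq] allows this replacement under [raise n]. *)
  apply: vi; rewrite vb vb' (collapse_raise_raise su un nm sm).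
  apply: collapse_raise_eq => //.
  - apply/cylP => i iS; rewrite raise_agree ?((cylP _ _).1 su) //.
    by apply: ltn_trans nm; rewrite size_sword in iS.
  - by rewrite raise_agree.
  - by rewrite -vm vE.
move=> /(congr1 (@^~ j)); rewrite /raise (negbTE j0) /a' /raise eqxx aj.
by [].
Qed.

Lemma not_dichotomy_injective :
  ~ dichotomy R (inj_reducible A1 (closure A1 `\` A1)).
Proof.
move=> H; have pC := polish_cantor R.
have aGA : analytic R GA := analytic_image graph_map_continuous analytic_A1.
have aGB : analytic R GB := analytic_image graph_map_continuous analytic_diagonal.
have GAB0 : GA `&` GB = set0.
  rewrite -subset0 => _ [[[a b] /A1_raise[n [sa an ba]] <-] [[x y] /= <- [xa cxb]]].
  have [_ c0 c1] := collapse_raise sa an.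
  by move: c0; rewrite -xa cxb ba c1.
have [[sep|/not_inj_reducible//] _] := H _ _ pC pC _ _ aGA aGB GAB0.
apply: (separable_irreducible pC pC sep); exists id, collapse; split.
- by move=> x; exact: cvg_id.
- exact: collapse_continuous.
- by move=> [a b] ab; exists (a, b).
- by rewrite A1_boundary => -[a b] /= ab; exists (a, b).
Qed.

End Counterexamples.

Theorem theorem9 (R : realType) :
  [/\ dichotomy R (reducible A1 (closure A1 `\` A1)),
      ~ dichotomy R (reducible A1 (~` A1))
    & ~ dichotomy R (inj_reducible A1 (closure A1 `\` A1))].
Proof.
split; [exact: reducible_dichotomy|exact: not_dichotomy_complement|].
exact: not_dichotomy_injective.
Qed.
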